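(* Let $M$ be a compact hyperbolic manifold or a flat torus of unit volume, let $k$ be an admissible potential on $M$, and let $h$, $(r_n)_{n\ge1}$, $(\varphi_n)_{n\ge 1}$ be the associated transform and spectral data (all as defined in the context). Let $N\ge 1$ and let $(x_1,\dots,x_N)\in M^N$. Then the configuration $\{x_1,\dots,x_N\}$ is in equilibrium if and only if $(x_1,\dots,x_N)$ is a critical point on $M^N$ of the function $$(y_1,\dots,y_N)\longmapsto \sum_{n=1}^\infty h(r_n)\,|\varphi_n(y_1)+\cdots+\varphi_n(y_N)|^2 .$$ In particular, a single point $x\in M$ is in equilibrium under self action if and only if $x$ is a critical point on $M$ of the function $y\mapsto\sum_{n=1}^\infty h(r_n)|\varphi_n(y)|^2$.
   Context: Setting. Either $M=\Gamma\backslash \mathbb{H}^m$ is a compact hyperbolic manifold, with universal cover $X=\mathbb{H}^m$ and $\Gamma$ the corresponding group of deck transformations, or $M=\Gamma\backslash\mathbb{R}^m$ is a flat torus of unit volume, with $X=\mathbb{R}^m$ and $\Gamma$ a lattice acting by translations. Write $d$ for the distance on $X$; points of $M$ are identified with chosen lifts to $X$. Spectral data. In the hyperbolic case $(\varphi_n)_{n\ge1}$ is an orthonormal system of Laplace eigenfunctions on $M$ spanning the orthogonal complement of the constants, with Laplace eigenvalues $\lambda_n=\left(\frac{m-1}{2}\right)^2+r_n^2$ (one choice of $r_n$ for each $n$), and $h$ is the Selberg transform of $k$, i.e. $h(r_n)$ is the eigenvalue on $\varphi_n$ of the integral operator with point-pair invariant kernel $k(d(x,y))$ on $X$. In the flat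 case the index $n$ is replaced by the non-zero elements $\nu$ of the dual lattice of $\Gamma$, $\varphi_\nu(x)=e^{2\pi i(\nu,x)}$, and $h(r_n)$ is replaced by $h(\nu)$, where $h$ is the Fourier transform $h(\nu)=\int_{\mathbb{R}^m}k(|x|)e^{-2\pi i(\nu,x)}\,dx$ of the radial function $k(|x|)$. Potential and force. $k:(-\infty,\infty)\to\mathbb{R}$ is an even $C^\infty$ function, and the force law is $H(\rho)=-k'(\rho)$, so $H(0)=0$. The potential $k$ is called admissible if it satisfies decay and regularity conditions ensuring that the series below, together with their termwise first derivatives, converge absolutely and uniformly, and that the Selberg pre-trace formula (hyperbolic case) or the Poisson summation formula (flat case) applies to it, so that for all $x,y$ $$\sum_{\gamma\in\Gamma}H(d(x,\gamma y))\vec V_\gamma=-\nabla_x\sum_{\gamma\in\Gamma}k(d(x,\gamma y))=-\nabla_x\sum_{n=1}^\infty h(r_n)\varphi_n(x)\overline{\varphi_n(y)} .$$ Here $\vec V_\gamma$ is the unit tangent vector at $x$ of the directed geodesic segment in $X$ from $\gamma y$ to $x$, a term with $\gamma y=x$ being taken to be $0$, and $\nabla_x$ is the gradient in the variable $x$ with $y$ held fixed. The effect (force) at $x$ of a unit charge at $y$ is $\sum_{\gamma\in\Gamma}H(d(x,\gamma y))\vec V_\gamma$; for $y=x$ (self action) it is $\sum_{\gamma\in\Gamma,\ \gamma\ne\mathrm{id}}H(d(x,\gamma x))\vec V_\gamma$. The force at $x_j$ due to the configuration $\{x_1,\dots,x_N\}$ is the sum over $i=1,\dots,N$ (including the self action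 $i=j$) of the effects at $x_j$ of unit charges at $x_i$. The configuration is in equilibrium if this force is zero at every $x_j$, $j=1,\dots,N$; a single point is in equilibrium under self action if the case $N=1$ holds. *)

(* Defs.v *)
From HB Require Import structures.
From mathcomp Require Import all_boot all_order all_algebra finmap.
From mathcomp Require Import complex.
From mathcomp Require Import all_classical all_reals all_analysis.
From mathcomp.analysis.showcase Require Import summability.

Set Implicit Arguments.
Unset Strict Implicit.
Unset Printing Implicit Defensive.

Import Order.TTheory GRing.Theory Num.Theory.
Import numFieldNormedType.Exports.

Local Open Scope classical_set_scope.
Local Open Scope ring_scope.
Local Open Scope complex_scope.

(** * Lebesgue measure on R^n, as an iterated product of [lebesgue_measure] *)

Section lebesgue_tuple.
Variable R : realType.
Let B := measurableTypeR R.

Definition cons_pair n (p : B * n.-tuple B) : n.+1.-tuple B :=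
  [tuple of p.1 :: p.2].

Lemma measurable_cons_pair n : measurable_fun setT (@cons_pair n).
Proof. exact: (@measurable_cons _ _ _ _ fst n snd). Qed.

Definition uncons_pair n (t : n.+1.-tuple B) : B * n.-tuple B :=
  (thead t, [tuple of behead t]).

Lemma measurable_uncons_pair n : measurable_fun setT (@uncons_pair n).
Proof.
apply/measurable_fun_pairP; split.
  exact: (@measurable_tnth _ _ n.+1 ord0).
exact: measurable_behead.
Qed.

Lemma cons_pairK n : cancel (@cons_pair n) (@uncons_pair n).
Proof.
move=> [x t]; rewrite /uncons_pair /cons_pair /=; congr (_, _).
exact: val_inj.
Qed.

Section cons_measure.
Variables (n : nat) (mu : {sigma_finite_measure set (n.-tuple B) -> \bar R}).

Let lam : {sigma_finite_measure set B -> \bar R} := @lebesgue_measure R.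

Definition cons_measure : set (n.+1.-tuple B) -> \bar R :=
  pushforward (lam \x mu)%E (@cons_pair n).

Let cons_measure0 : cons_measure set0 = 0%E.
Proof. by rewrite /cons_measure /pushforward preimage_set0 measure0. Qed.

Let cons_measure_ge0 A : (0 <= cons_measure A)%E.
Proof. by rewrite /cons_measure /pushforward measure_ge0. Qed.

Let cons_measure_sigma_additive : semi_sigma_additive cons_measure.
Proof.
move=> G mG tG mUG; rewrite /cons_measure /pushforward preimage_bigcup.
have mpre A : measurable A -> measurable (@cons_pair n @^-1` A).
  move=> mA; rewrite -[X in measurable X]setTI.
  exact: (measurable_cons_pair measurableT mA).
apply: measure_semi_sigma_additive.
- by move=> i; exact: mpre.
- apply/trivIsetP => /= i j _ _ ij; rewrite -preimage_setI.
  by move/trivIsetP : tG => /(_ _ _ _ _ ij) ->//; rewrite preimage_set0.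
- by rewrite -preimage_bigcup; exact: mpre.
Qed.

HB.instance Definition _ := isMeasure.Build _ _ _ cons_measure
  cons_measure0 cons_measure_ge0 cons_measure_sigma_additive.

Let cons_measure_sigma_finite : sigma_finite setT cons_measure.
Proof.
have [G GT Gfin] : sigma_finite setT (lam \x mu)%E.
  have /sigma_finiteP[F [TF ndF Foo]] := sigma_finiteT lam.
  have /sigma_finiteP[G [TG ndG Goo]] := sigma_finiteT mu.
  exists (fun i => F i `*` G i).
    rewrite -setXTT TF TG predeqE => -[x y]; split.
      move=> [/= [i _ Fix] [j _ Gjy]]; exists (maxn i j) => //; split.
      - by move: x Fix; exact/subsetPset/ndF/leq_maxl.
      - by move: y Gjy; exact/subsetPset/ndG/leq_maxr.
    by move=> [i _ []/= ? ?]; split; exists i.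
  move=> i; have [? ?] := Foo i; have [? ?] := Goo i.
  split; first exact: measurableX.
  by rewrite product_measure1E// lte_mul_pinfty// ge0_fin_numE.
exists (fun i => @uncons_pair n @^-1` G i).
  by rewrite -preimage_bigcup -GT preimage_setT.
move=> i; have [mG Goo] := Gfin i; split.
  rewrite -[X in measurable X]setTI.
  exact: (measurable_uncons_pair measurableT mG).
rewrite /cons_measure /pushforward -comp_preimage.
rewrite (_ : @uncons_pair n \o @cons_pair n = id) ?preimage_id//.
by apply/funext => p /=; rewrite cons_pairK.
Qed.

HB.instance Definition _ :=
  @Measure_isSigmaFinite.Build _ _ _ cons_measure cons_measure_sigma_finite.
End cons_measure.

Fixpoint lebesgue_tuple n : {sigma_finite_measure set (n.-tuple B) -> \bar R} :=
  match n with
  | 0 => \d_([tuple] : 0.-tuple B)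
  | n'.+1 => cons_measure (lebesgue_tuple n')
  end.

End lebesgue_tuple.

(** * The model spaces *)

(* Both spaces are open subsets of R^(m.+1) (row vectors) with a metric
   conformal to the Euclidean one: [Hyperbolic] is the upper half-space model
   of H^(m.+1), the last coordinate being the positive one, and [Flat] is
   R^(m.+1).  Points of M = Gamma \ X are represented by their lifts, elements
   of [model_space g], and functions on M by Gamma-invariant functions. *)
Inductive geometry := Hyperbolic | Flat.

Section model_spaces.
Variables (R : realType) (m : nat).
Local Notation pt := 'rV[R]_m.+1.
Implicit Types (g : geometry) (x y p v nu : pt) (A F K : set pt).

Definition height x : R := x 0 ord_max.

Definition model_space g : set pt :=
  match g with Hyperbolic => [set x | 0 < height x] | Flat => setT end.

Definition dot x y : R := \sum_i x 0 i * y 0 i.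

(* [`|x|] on matrices is the sup norm, hence this definition. *)
Definition enorm x : R := Num.sqrt (dot x x).

Definition arcosh (t : R) : R := ln (t + Num.sqrt (t ^+ 2 - 1)).

Definition dist g x y : R :=
  match g with
  | Hyperbolic => arcosh (1 + enorm (x - y) ^+ 2 / (2 * height x * height y))
  | Flat => enorm (x - y)
  end.

(* Density of the Riemannian volume with respect to Lebesgue measure. *)
Definition volume_density g x : R :=
  match g with Hyperbolic => height x ^- m.+1 | Flat => 1 end.

(* In a complete simply connected space of constant curvature <= 0 the geodesic
   segments parametrized by arc length are the isometric embeddings of
   intervals. *)
Definition geodesic_segment g p x (c : R -> pt) : Prop :=
  [/\ c 0 = p, c (dist g p x) = x
    & forall s t, s \in `[0, dist g p x] -> t \in `[0, dist g p x] ->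
        model_space g (c s) /\ dist g (c s) (c t) = `|s - t|].

Definition is_end_velocity g p x v : Prop :=
  exists2 c : R -> pt, geodesic_segment g p x c
    & s^-1 *: (c (dist g p x) - c (dist g p x - s)) @[s --> 0^'+] --> v.

(* Unit tangent vector at x of the directed geodesic segment from p to x,
   for p <> x. *)
Definition unit_tangent g p x : pt := get [set v | is_end_velocity g p x v].

(** * Integration with respect to the Riemannian volume *)

Definition point_of_tuple (t : m.+1.-tuple (measurableTypeR R)) : pt :=
  \row_i tnth t i.

Definition borel_set A : Prop := measurable (point_of_tuple @^-1` A).

Definition borel_fun A (f : pt -> R) : Prop :=
  measurable_fun (point_of_tuple @^-1` A) (f \o point_of_tuple).

Definition vintegrable g A (f : pt -> R) : Prop :=
  (lebesgue_tuple R m.+1).-integrable (point_of_tuple @^-1` A)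
    (EFin \o (fun t => f (point_of_tuple t) *
                       volume_density g (point_of_tuple t))).

Definition vintegral g A (f : pt -> R) : R :=
  \int[lebesgue_tuple R m.+1]_(t in point_of_tuple @^-1` A)
    (f (point_of_tuple t) * volume_density g (point_of_tuple t)).

Definition cvintegrable g A (f : pt -> R[i]) : Prop :=
  vintegrable g A (fun x => complex.Re (f x)) /\
  vintegrable g A (fun x => complex.Im (f x)).

Definition cvintegral g A (f : pt -> R[i]) : R[i] :=
  vintegral g A (fun x => complex.Re (f x)) +i*
  vintegral g A (fun x => complex.Im (f x)).

(** * Differential operators, in the coordinates of R^(m.+1) *)

Definition partial (i : 'I_m.+1) (u : pt -> R) x : R :=
  'D_(delta_mx 0 i) u x.

Definition partials (u : pt -> R) x : pt := \row_i partial i u x.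

Fixpoint Ck (k : nat) A (u : pt -> R) : Prop :=
  (forall x, A x -> {for x, continuous u}) /\
  match k with
  | 0 => True
  | k'.+1 => forall i, (forall x, A x -> derivable u x (delta_mx 0 i)) /\
                       Ck k' A (partial i u)
  end.

(* Laplace-Beltrami operator of the half-space metric: with d = m.+1 and y the
   last coordinate, it is y^2 (sum_i d_i^2) - (d - 2) y d_y. *)
Definition hyperbolic_laplacian (u : pt -> R) x : R :=
  height x ^+ 2 * (\sum_i partial i (partial i u) x)
  - (m%:R - 1) * height x * partial ord_max u x.

Definition laplace_eigenfunction (lam : R) (f : pt -> R[i]) : Prop :=
  forall u,
    u = (fun x => complex.Re (f x)) \/ u = (fun x => complex.Im (f x)) ->
    Ck 2 (model_space Hyperbolic) u /\
    forall x, model_space Hyperbolic x ->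
      hyperbolic_laplacian u x + lam * u x = 0.

(* f is differentiable (over R) at x with zero differential. *)
Definition critical_point (V : normedModType R) (f : V -> R[i]) (x : V) :=
  forall u,
    u = (fun z => complex.Re (f z)) \/ u = (fun z => complex.Im (f z)) ->
    differentiable u x /\ forall w, 'd u x w = 0.

(** * Groups of deck transformations *)

Section deck_group.
Variables (Gam : groupType) (act : Gam -> pt -> pt).

Record compact_space_form g : Prop := CompactSpaceForm {
  deck_stable : forall a x, model_space g x -> model_space g (act a x);
  deck_act1 : forall x, model_space g x -> act 1%g x = x;
  deck_actM : forall a b x, model_space g x ->
    act (a * b)%g x = act a (act b x);
  deck_isometry : forall a x y, model_space g x -> model_space g y ->
    dist g (act a x) (act a y) = dist g x y;
  deck_free : forall a x, model_space g x -> act a x = x -> a = 1%g;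
  deck_proper : forall K, compact K -> K `<=` model_space g ->
    finite_set [set a | (act a @` K) `&` K !=set0];
  deck_cocompact : exists K, [/\ compact K, K `<=` model_space g
    & forall x, model_space g x -> exists a, K (act a x)]
}.

Definition acts_by_translations : Prop :=
  forall a, exists v, forall x, act a x = x + v.

(* A Borel set of representatives, used to integrate over Gamma \ X. *)
Definition fundamental_domain g F : Prop :=
  [/\ borel_set F, F `<=` model_space g
    & forall x, model_space g x -> exists! a, F (act a x)].

Definition volume g F : R := vintegral g F (fun _ => 1).

Definition lattice_vector : set pt := range (fun a => act a 0).

Definition dual_lattice : set pt :=
  [set nu | forall v, lattice_vector v -> exists z : int, dot nu v = z%:~R].

Definition nonzero_dual_lattice : set pt := dual_lattice `\ 0.

Definition dual_vector (nu : nonzero_dual_lattice) : pt := val nu.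

(** * Sums over infinite index sets *)

(* Series are unordered sums, over the net of finite subsets of the index set;
   they are only used where convergence is absolute. *)
Definition csum (I : choiceType) (f : I -> R[i]) : R[i] :=
  summability.sum (fun i => complex.Re (f i) : R^o) +i*
  summability.sum (fun i => complex.Im (f i) : R^o).

Definition abs_unif_summable (V : normedModType R) (I : choiceType)
    (A : set (pt * pt)) (f : I -> pt -> pt -> V) : Prop :=
  exists S : pt * pt -> R^o,
    {uniform A, (fun (J : {fset I}) q =>
       partial_sum (fun i => `|f i q.1 q.2| : R^o) J) @ totally --> S}.

(* Absolute and uniform convergence, on compact sets, of a series of functions
   of (x, y) and of its termwise first derivatives in x.  On compact sets the
   norm of [partials] is comparable with that of the Riemannian gradient. *)
Definition C1_summable g (I : choiceType) (f : I -> pt -> pt -> R) : Prop :=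
  forall K, compact K -> K `<=` model_space g ->
    @abs_unif_summable R^o I (K `*` K) f /\
    abs_unif_summable (K `*` K)
      (fun i x y => partials (fun z => f i z y) x).

(** * Forces and equilibrium *)

Definition smooth_even (k : R -> R) : Prop :=
  (forall rho, k (- rho) = k rho) /\
  (forall n rho, derivable (derive1n n k) rho 1).

Definition force_law (k : R -> R) (rho : R) : R := - derive1 k rho.

Definition force_term g k x p : pt :=
  force_law k (dist g x p) *: unit_tangent g p x.

Definition effect g k x y : pt :=
  summability.sum (fun a : Gam =>
    if act a y == x then 0 else force_term g k x (act a y)).

Definition self_effect g k x : pt :=
  summability.sum (fun a : Gam =>
    if a == 1%g then 0 else force_term g k x (act a x)).

(* Configurations are matrices: the j-th row of X is (a lift of) x_j. *)
Definition equilibrium g k (N : nat) (X : 'M[R]_(N, m.+1)) : Prop :=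
  forall j : 'I_N,
    \sum_(i < N) (if i == j then self_effect g k (row j X)
                  else effect g k (row j X) (row i X)) = 0.

Definition self_equilibrium g k x : Prop := @equilibrium g k 1 x.

(** * Spectral side *)

(* phi n, lam n, r n stand for phi_(n+1), lambda_(n+1), r_(n+1); the dimension
   is m.+1, so that m%:R / 2 is (dim - 1) / 2.  The last clause is density of
   the span of the phi n in the orthogonal complement of the constants in
   L^2(M). *)
Record laplace_spectral_data F (lam : nat -> R) (r : nat -> R[i])
    (phi : nat -> pt -> R[i]) : Prop := LaplaceSpectralData {
  phi_invariant : forall n a x, model_space Hyperbolic x ->
    phi n (act a x) = phi n x;
  phi_eigen : forall n, laplace_eigenfunction (lam n) (phi n);
  lam_r : forall n, (lam n)%:C = (m%:R / 2)%:C ^+ 2 + r n ^+ 2;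
  phi_orthonormal : forall n n',
    cvintegral Hyperbolic F (fun x => phi n x * (phi n' x)^*) = (n == n')%:R;
  phi_mean0 : forall n, cvintegral Hyperbolic F (phi n) = 0;
  phi_dense : forall f : pt -> R[i],
    borel_fun F (fun x => complex.Re (f x)) ->
    borel_fun F (fun x => complex.Im (f x)) ->
    cvintegrable Hyperbolic F (fun x => `|f x| ^+ 2) ->
    cvintegral Hyperbolic F f = 0 ->
    forall e : R, 0 < e -> exists n (c : 'I_n -> R[i]),
      vintegral Hyperbolic F
        (fun x => complex.Re (`|f x - \sum_(i < n) c i * phi i x| ^+ 2)) < e
}.

(* Parameter of the constant eigenfunction: 0 = ((dim - 1) / 2)^2 + r^2. *)
Definition trivial_r : R[i] := 0 +i* (m%:R / 2).

(* h gives the eigenvalues of the operator with kernel k(d(x,y)) on the phi n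
   and on the constants. *)
Definition selberg_transform (k : R -> R) (r : nat -> R[i])
    (phi : nat -> pt -> R[i]) (h : R[i] -> R[i]) : Prop :=
  let T f x y := (k (dist Hyperbolic x y))%:C * f y : R[i] in
  let eigenvalue f z := forall x, model_space Hyperbolic x ->
    cvintegrable Hyperbolic (model_space Hyperbolic) (T f x) /\
    cvintegral Hyperbolic (model_space Hyperbolic) (T f x) = z * f x in
  eigenvalue (fun _ => 1) (h trivial_r) /\
  forall n, eigenvalue (phi n) (h (r n)).

Definition torus_character nu x : R[i] :=
  cos (2 * pi * dot nu x) +i* sin (2 * pi * dot nu x).

Definition fourier_transform (k : R -> R) (h : pt -> R[i]) : Prop :=
  forall nu,
    let f x := (k (enorm x))%:C * (torus_character nu x)^* in
    cvintegrable Flat setT f /\ h nu = cvintegral Flat setT f.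

(* [hv i] is h(r_n) or h(nu), and [h0] the value of h belonging to the constant
   eigenfunction vol(M)^(-1/2).  The last clause is the pre-trace formula, resp.
   the Poisson summation formula. *)
Definition admissible g F (k : R -> R) (I : choiceType)
    (phi : I -> pt -> R[i]) (hv : I -> R[i]) (h0 : R[i]) : Prop :=
  let term i x y := hv i * phi i x * (phi i y)^* in
  [/\ C1_summable g (fun a x y => k (dist g x (act a y))),
      C1_summable g (fun i x y => complex.Re (term i x y)),
      C1_summable g (fun i x y => complex.Im (term i x y))
    & forall x y, model_space g x -> model_space g y ->
        (summability.sum (fun a => k (dist g x (act a y)) : R^o))%:C
        = h0 / (volume g F)%:C + csum (fun i => term i x y)].

End deck_group.
End model_spaces.

(* Main.v *)
Require Import Defs.
From HB Require Import structures.
From mathcomp Require Import all_boot all_order all_algebra finmap.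
From mathcomp Require Import complex.
From mathcomp Require Import all_classical all_reals all_analysis.
From mathcomp.analysis.showcase Require Import summability.
From mathcomp Require Import ring lra.
Import Order.TTheory GRing.Theory Num.Theory.
Import numFieldNormedType.Exports.
Local Open Scope classical_set_scope.
Local Open Scope ring_scope.

(** Summing the potential over the images of y gives a function K(x,y), here
    [image_potential], whose gradient in x is, up to the conformal factor, minus
    the force exerted at x by a charge at y.  The pre-trace or Poisson formula
    says that K(x,y) is a constant plus the sum over n of
    h(r_n) phi_n(x) conj(phi_n(y)).  Expanding the square of the absolute value
    of phi_n(y_1) + ... + phi_n(y_N), the function of the theorem is, up to a
    constant, the sum of K(y_j,y_i) over all pairs (j,i).  Since K is symmetric,
    each point occurs twice, and the gradient of this sum in y_j is twice the
    sum over i of the gradient of K(.,y_i) at y_j, which is proportional to the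
    total force at y_j.  The pairs (j,j) give the self action: the identity
    element contributes nothing, because an even potential has no force at
    distance 0.

    Three points need work.

    - The force is defined by unit tangent vectors of geodesics, and one must
      know that these are the Riemannian gradients of the distance.  A vector v
      that is the velocity at x of a geodesic arriving from p has Riemannian
      norm one ([end_velocity_norm]) and pairs to one with the gradient of the
      distance to p ([end_velocity_gradient]), which has norm one as well
      ([gradient_dist]).  So v is that gradient, by the equality case of the
      Cauchy-Schwarz inequality.  That there is a geodesic follows from an
      explicit formula ([end_velocity_exists]).

    - Being critical includes being differentiable in all the points jointly,
      so K has to be differentiable in the pair (x,y).  Along the spectral
      series this is immediate: each term is a finite sum of products
      of a function of x and a function of y, hence has a derivative in x that
      is locally uniform in y, and this property passes to the sum
      ([has_gradient_series], [image_potential_gradient]).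

    - Termwise differentiation of the series over the group identifies the
      gradient of K with the series of forces ([image_gradient_at],
      [effectE]). *)

Set Implicit Arguments.
Unset Strict Implicit.
Unset Printing Implicit Defensive.

#[local] Existing Instance totally_filter.

(** * Unordered sums *)

Definition has_sum (R : realType) (V : normedModType R) (I : choiceType)
    (f : I -> V) (S : V) : Prop :=
  partial_sum f @ totally --> S.

(** With f nonnegative, this is the Cauchy criterion for convergence of the
    unordered sum of the f i, uniformly on A. *)
Definition small_tails (R : realType) (I : choiceType) (T : Type) (A : set T)
    (f : I -> T -> R) : Prop :=
  forall e, 0 < e -> exists J0 : {fset I}, forall L : {fset I},
    [disjoint L & J0]%fset -> forall q, A q -> \sum_(i <- L) f i q <= e.

Section unordered_sums.
Variables (R : realType) (I : choiceType).
Implicit Types (J L : {fset I}).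

Lemma partial_sumE (V : zmodType) (f : I -> V) J :
  partial_sum f J = \sum_(i <- J) f i.
Proof. by rewrite big_seq_fsetE. Qed.

Lemma sum_fset_split (V : zmodType) (f : I -> V) J0 J : (J0 `<=` J)%fset ->
  \sum_(i <- J) f i = \sum_(i <- J0) f i + \sum_(i <- (J `\` J0)%fset) f i.
Proof.
move=> J0J; rewrite (big_fsetID _ (mem J0)) /=; congr (_ + _).
  apply: eq_fbigl => i; rewrite !inE/= andbC.
  by case: (boolP (i \in J0)) => //= /(fsubsetP J0J).
by apply: eq_fbigl => i; rewrite !inE/= andbC.
Qed.

Lemma has_sum_sum (V : normedModType R) (f : I -> V) S :
  has_sum f S -> summability.sum f = S.
Proof. by move=> fS; apply: cvg_lim. Qed.

Lemma has_sumD (V : normedModType R) (f g : I -> V) S T :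
  has_sum f S -> has_sum g T -> has_sum (fun i => f i + g i) (S + T).
Proof.
move=> fS gT; rewrite /has_sum.
rewrite (_ : partial_sum _ = partial_sum f \+ partial_sum g); first exact: cvgD.
by apply/funext => J; rewrite /= !partial_sumE big_split.
Qed.

Lemma has_sum0 (V : normedModType R) : has_sum (fun _ : I => 0 : V) 0.
Proof.
rewrite /has_sum (_ : partial_sum _ = cst 0); first exact: cvg_cst.
by apply/funext => J; rewrite partial_sumE big1.
Qed.

Lemma has_sum_big (V : normedModType R) (K : Type) (r : seq K)
    (f : K -> I -> V) (S : K -> V) :
  (forall k, has_sum (f k) (S k)) ->
  has_sum (fun i => \sum_(k <- r) f k i) (\sum_(k <- r) S k).
Proof.
move=> fS; elim: r => [|k r IH].
  rewrite big_nil (_ : (fun _ => _) = fun=> 0); first exact: has_sum0.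
  by apply/funext => i; rewrite big_nil.
rewrite big_cons (_ : (fun _ => _) = fun i => f k i + \sum_(k <- r) f k i).
  exact: has_sumD.
by apply/funext => i; rewrite big_cons.
Qed.

Lemma has_sumZ (V : normedModType R) (c : R) (f : I -> V) S :
  has_sum f S -> has_sum (fun i => c *: f i) (c *: S).
Proof.
move=> fS; rewrite /has_sum.
rewrite (_ : partial_sum _ = (fun J => c *: partial_sum f J)); first exact: cvgZl_tmp.
by apply/funext => J; rewrite !partial_sumE scaler_sumr.
Qed.

Lemma has_sum_reindex (V : normedModType R) (s t : I -> I) (f : I -> V) S :
  cancel s t -> cancel t s -> has_sum f S -> has_sum (f \o s) S.
Proof.
move=> st ts fS; rewrite /has_sum.
have image_cvg : (fun J => [fset s i | i in J]%fset) @ totally --> totally.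
  move=> P [J0 _ J0P]; exists [fset t i | i in J0]%fset => // J /= J0J.
  apply: J0P => /=; apply/fsubsetP => i iJ0.
  apply/imfsetP; exists (t i); last by rewrite ts.
  by apply: (fsubsetP J0J); apply/imfsetP; exists i.
rewrite (_ : partial_sum _ = partial_sum f \o (fun J => [fset s i | i in J]%fset)).
  exact: cvg_comp image_cvg fS.
apply/funext => J /=; rewrite !partial_sumE big_imfset //=.
by move=> i j _ _; apply: (can_inj st).
Qed.

Lemma abs_unif_summable_tails (V W : normedModType R) (A : set (V * V))
    (f : I -> V -> V -> W) (S : V * V -> R^o) :
  {uniform A, (fun (J : {fset I}) q =>
       partial_sum (fun i => `|f i q.1 q.2| : R^o) J) @ totally --> S} ->
  small_tails A (fun i q => `|f i q.1 q.2|).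
Proof.
move=> fS e e0.
have [] := fS [set g | forall q, A q -> `|S q - g q| < e / 2].
  apply/uniform_nbhs; exists [set p | `|p.1 - p.2| < e / 2]; split => //.
  rewrite -entourage_ballE; exists (e / 2) => /=; first by rewrite divr_gt0.
  by move=> [a b]; rewrite /ball /= /ball_ .
move=> J0 _ J0P; exists J0 => L LJ0 q Aq.
have h1 := J0P J0 (fsubset_refl _) q Aq.
have h2 := J0P (J0 `|` L)%fset (fsubsetUl _ _) q Aq.
move: h1 h2; rewrite /= !partial_sumE.
rewrite (@sum_fset_split _ _ J0 (J0 `|` L)%fset) ?fsubsetUl//.
have -> : ((J0 `|` L) `\` J0)%fset = L.
  rewrite fsetDUl fsetDv fset0U; apply/fsetP => i; rewrite !inE.
  case: (boolP (i \in L)) => iL; rewrite ?andbF// andbT.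
  by apply: contraTN iL => iJ; apply: (fdisjointP_sym LJ0).
set a := \sum_(i <- J0) _; set b := \sum_(i <- L) _; set s := S q.
by rewrite /Num.norm /= !ltr_norml => /andP[? ?] /andP[? ?]; lra.
Qed.


Lemma small_tails_cauchy (V : normedModType R) (T : Type) (A : set T)
    (q : T) (f : I -> T -> V) :
  small_tails A (fun i q => `|f i q|) -> A q ->
  cauchy (partial_sum (fun i => f i q) @ totally).
Proof.
move=> tf Aq; apply/cauchy_exP => e e0.
have [J0 J0P] := tf (e / 2) (divr_gt0 e0 (ltr0Sn _ _)).
exists (\sum_(i <- J0) f i q); exists J0 => // J /= J0J.
rewrite -ball_normE /= partial_sumE (sum_fset_split _ J0J) opprD addNKr normrN.
apply: le_lt_trans (ler_norm_sum _ _ _) _.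
apply: le_lt_trans (J0P _ _ q Aq) _; last by lra.
by apply/fdisjointP => i; rewrite !inE => /andP[].
Qed.

(** An error bound for a finite partial sum: it suffices to bound the finite
    sums that avoid its index set. *)
Lemma has_sum_tail (V : normedModType R) (f : I -> V) S J0 e :
  has_sum f S ->
  (forall L, [disjoint L & J0]%fset -> `|\sum_(i <- L) f i| <= e) ->
  `|S - \sum_(i <- J0) f i| <= e.
Proof.
move=> fS tf; apply/ler_addgt0Pl => d d0.
have [J1 _ J1P] := (cvgrPdist_lt _ _).1 fS d d0.
have := J1P (J1 `|` J0)%fset (fsubsetUl _ _) => /=.
rewrite partial_sumE (@sum_fset_split _ _ J0) ?fsubsetUr// => /ltW h.
set L := (_ `\` _)%fset in h.
have LJ0 : [disjoint L & J0]%fset.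
  by apply/fdisjointP => i; rewrite !inE => /andP[].
rewrite (_ : S - _ = S - (\sum_(i <- J0) f i + \sum_(i <- L) f i)
  + \sum_(i <- L) f i); last by rewrite opprD addrA subrK.
by apply: le_trans (ler_normD _ _) _; apply: lerD => //; exact: tf.
Qed.

End unordered_sums.

(** * Gradients *)

Section linear_approximation.
Variables (R : realType) (V : normedModType R).

Lemma differentiable_approx (f : V -> R) (x : V) :
  differentiable f x -> forall e, 0 < e ->
  \forall z \near x, `|f z - f x - 'd f x (z - x)| <= e * `|z - x|.
Proof.
move=> /diff_locally fx e e0.
have /eqaddoP/(_ e e0) := fx.
rewrite (near_shift 0 x) /=; apply: filterS => z /=.
by rewrite subr0 addrK -addrA -opprD.
Qed.

Lemma approx_differentiable (f : V -> R) (x : V) (l : V -> R) :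
  linear l -> continuous l ->
  (forall e, 0 < e ->
    \forall z \near x, `|f z - f x - l (z - x)| <= e * `|z - x|) ->
  differentiable f x /\ 'd f x = l :> (V -> R).
Proof.
move=> ll cl fx.
pose lM := GRing.isLinear.Build _ _ _ _ _ ll.
pose lL : {linear _ -> _} := HB.pack l lM.
have fxo : f \o shift x = cst (f x) + l +o_ 0 id.
  apply/eqaddoP => e e0; have := fx e e0.
  rewrite (near_shift 0 x) /=; apply: filterS => z /=.
  by rewrite subr0 addrK -addrA -opprD.
have dfl := @diff_unique _ _ _ _ lL _ cl fxo.
by split => //; apply/diff_locallyP; rewrite dfl.
Qed.

End linear_approximation.

Section dot_product.
Variables (R : realType) (m : nat).
Local Notation pt := 'rV[R]_m.+1.
Implicit Types x y v w : pt.

Lemma dotC v w : dot v w = dot w v.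
Proof. by apply: eq_bigr => i _; rewrite mulrC. Qed.

Lemma dot_is_linear v : linear (dot v).
Proof.
move=> a x y; rewrite /dot scaler_sumr -big_split; apply: eq_bigr => i _ /=.
by rewrite !mxE mulrDr mulrCA.
Qed.

HB.instance Definition _ v := GRing.isLinear.Build R pt R *%R (dot v)
  (@dot_is_linear v).

Lemma dotDl x y v : dot (x + y) v = dot x v + dot y v.
Proof. by rewrite dotC linearD /= !(dotC v). Qed.

Lemma dotZl a x v : dot (a *: x) v = a * dot x v.
Proof. by rewrite dotC linearZ /= (dotC v). Qed.

Lemma dotNl x v : dot (- x) v = - dot x v.
Proof. by rewrite dotC linearN /= (dotC v). Qed.

Lemma dotBl x y v : dot (x - y) v = dot x v - dot y v.
Proof. by rewrite dotDl dotNl. Qed.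

Lemma dot_suml (I : Type) (r : seq I) (P : pred I) (F : I -> pt) v :
  dot (\sum_(i <- r | P i) F i) v = \sum_(i <- r | P i) dot (F i) v.
Proof. by rewrite dotC linear_sum /=; apply: eq_bigr => i _; rewrite dotC. Qed.

Lemma dot_delta v i : dot v (delta_mx 0 i) = v 0 i.
Proof.
rewrite /dot (bigD1 i) //= big1 => [|j ji]; rewrite mxE eqxx.
  by rewrite eqxx mulr1 addr0.
by rewrite (negbTE ji) mulr0.
Qed.

Lemma dot_ge0 v : 0 <= dot v v.
Proof. by apply: sumr_ge0 => i _; rewrite -expr2 sqr_ge0. Qed.

Lemma dot_eq0 v : dot v v = 0 -> v = 0.
Proof.
move=> /eqP; rewrite psumr_eq0 => [/allP v0|i _]; last by rewrite -expr2 sqr_ge0.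
apply/rowP => i; rewrite mxE; apply/eqP.
by have := v0 i (mem_index_enum i); rewrite /= mulf_eq0 orbb.
Qed.

Lemma coord_le_norm v i : `|v 0 i| <= `|v|.
Proof.
rewrite [leRHS]/Num.norm /= mx_normrE.
exact: (le_bigmax _ (fun ij : 'I_1 * 'I_m.+1 => `|v ij.1 ij.2|) (0, i)).
Qed.

Lemma sum_coord_le_norm (c : R) v w : (forall i, `|v 0 i| <= c) ->
  \sum_i `|v 0 i| * `|w 0 i| <= m.+1%:R * c * `|w|.
Proof.
move=> vc; rewrite -mulrA mulr_natl -[X in _ *+ X](card_ord m.+1) -sumr_const.
apply: ler_sum => i _; apply: ler_pM => //; exact: coord_le_norm.
Qed.

Lemma dot_le_norm v w : `|dot v w| <= m.+1%:R * `|v| * `|w|.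
Proof.
apply: le_trans (ler_norm_sum _ _ _) _; under eq_bigr do rewrite normrM.
by apply: sum_coord_le_norm => i; exact: coord_le_norm.
Qed.

Lemma dot_continuous v : continuous (dot v).
Proof.
have -> : dot v = (fun w => \sum_i v 0 i * w 0 i) by [].
apply: continuous_big => [|i _ x]; first exact: add_continuous.
apply: (@cvgMl_tmp R pt (nbhs x) _ _ (v 0 i)).
exact: (@coord_continuous R 1 m.+1 0 i).
Qed.

End dot_product.

Section mean_value.
Variables (R : realType) (m : nat).
Local Notation pt := 'rV[R]_m.+1.
Implicit Types x y v w : pt.

(** Both components hold because the difference quotients are the same function;
    they reduce partial derivatives to derivatives of functions of one
    variable. *)
Lemma derive_line (V : normedModType R) (u : V -> R) (z v : V) s :
  ('D_1 (fun h : R => u (z + h *: v)) s = 'D_v u (z + s *: v)) *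
  (derivable (fun h : R => u (z + h *: v)) s 1 = derivable u (z + s *: v) v).
Proof.
rewrite /derive /derivable.
have E : (fun h : R => h^-1 *:
    (((fun h : R => u (z + h *: v)) \o shift s) (h *: 1) - u (z + s *: v))) =
  (fun h : R => h^-1 *: ((u \o shift (z + s *: v)) (h *: v) - u (z + s *: v))).
  by apply/funext => h; rewrite /= [h *: 1]mulr1 scalerDl addrCA.
by rewrite E.
Qed.

Lemma mean_value_le (f : R -> R) (a b M : R) : a <= b ->
  (forall s, a <= s <= b -> derivable f s 1 /\ `|'D_1 f s| <= M) ->
  `|f b - f a| <= M * (b - a).
Proof.
move=> ab fM; have [||c cab ->] := @MVT_segment R f ('D_1 f) a b ab.
- move=> s; rewrite in_itv => /andP[/ltW sa /ltW sb].
  by apply/derivableP; have [] := fM s; rewrite ?sa.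
- apply: derivable_within_continuous => s; rewrite in_itv => sab.
  by have [] := fM s sab.
rewrite normrM [X in _ * X]ger0_norm ?subr_ge0// ler_wpM2r ?subr_ge0//.
by have [] := fM c.
Qed.

Lemma mean_value_line (V : normedModType R) (u : V -> R) (z v : V) (h M : R) :
  (forall s, `|s| <= `|h| -> 0 <= s * h ->
     derivable u (z + s *: v) v /\ `|'D_v u (z + s *: v)| <= M) ->
  `|u (z + h *: v) - u z| <= M * `|h|.
Proof.
move=> uM; pose f (s : R) := u (z + s *: v).
have -> : u z = f 0 by rewrite /f scale0r addr0.
have fM s : `|s| <= `|h| -> 0 <= s * h -> derivable f s 1 /\ `|'D_1 f s| <= M.
  by move=> sh s0; rewrite /f !derive_line; apply: uM.
have [h0|h0] := leP 0 h.
  rewrite (ger0_norm h0) -[h in leRHS]subr0; apply: mean_value_le => // s /andP[s0 sh].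
  by apply: fM; rewrite ?ger0_norm// mulr_ge0.
rewrite distrC (ltr0_norm h0) -[- h]add0r; apply: mean_value_le => [|s /andP[hs s0]].
  exact: ltW.
by apply: fM; rewrite ?(ltr0_norm h0) ?ler0_norm ?lerN2// mulr_le0// ltW.
Qed.

(** Moving from x0 to x one coordinate at a time stays in the sup-norm ball, so
    that bounds on the partial derivatives suffice. *)
Lemma mean_value_partials (u : pt -> R) x0 x (d : R) (c : 'I_m.+1 -> R) :
  `|x - x0| < d ->
  (forall z i, `|z - x0| < d ->
     derivable u z (delta_mx 0 i) /\ `|partial i u z| <= c i) ->
  `|u x - u x0| <= \sum_i c i * `|(x - x0) 0 i|.
Proof.
move=> xd uc.
pose z k : pt := \row_i (if (i < k)%N then x 0 i else x0 0 i).
have -> : u x - u x0 = \sum_(i < m.+1) (u (z i.+1) - u (z i)).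
  rewrite -(big_mkord xpredT (fun i => u (z i.+1) - u (z i))) telescope_sumr//.
  congr (u _ - u _); apply/rowP => i; rewrite mxE ?ltn0//.
  by rewrite ltn_ord.
apply: le_trans (ler_norm_sum _ _ _) _; apply: ler_sum => i _.
have -> : z i.+1 = z i + (x - x0) 0 i *: delta_mx 0 i.
  apply/rowP => j; rewrite !mxE eqxx /= ltnS leq_eqVlt.
  have [->|ji] := eqVneq j i; first by rewrite eqxx ltnn mulr1 addrCA subrr addr0.
  by rewrite (inj_eq val_inj) (negbTE ji) mulr0 addr0.
apply: mean_value_line => s sh s0; apply: uc.
apply: le_lt_trans xd; rewrite [leLHS]/Num.norm /= mx_normrE.
apply: bigmax_le => // -[j k] _ /=; rewrite (ord1 j).
have -> : (z i + s *: delta_mx 0 i - x0) 0 k =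
   if (k < i)%N then (x - x0) 0 k else if k == i then s else 0.
  rewrite !mxE eqxx /=; have [->|ki] := eqVneq k i.
    by rewrite ltnn mulr1 addrAC subrr add0r.
  by rewrite mulr0 addr0; case: ifP => // _; rewrite subrr.
case: ifP => [_|_]; first exact: coord_le_norm.
case: eqP => [_|_]; last by rewrite normr0.
exact: le_trans sh (coord_le_norm _ _).
Qed.

End mean_value.

(** * Series of functions with uniformly summable gradients *)

(** D is the gradient at x of f t, with an error that is uniform as t runs along
    G, although D does not depend on t.  If G is the filter of neighbourhoods
    of y, this is the half of joint differentiability at (x,y) that concerns the
    second argument of f; if G is concentrated at y, it is differentiability of
    f y. *)
Definition has_gradient (R : realType) (m : nat) (T : Type) (G : set_system T)
    (f : T -> 'rV[R]_m.+1 -> R) (x D : 'rV[R]_m.+1) : Prop :=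
  forall e, 0 < e -> \forall t \near G & z \near x,
    `|f t z - f t x - dot D (z - x)| <= e * `|z - x|.

Section gradients.
Variables (R : realType) (m : nat).
Local Notation pt := 'rV[R]_m.+1.
Implicit Types (x y v w D : pt).

Lemma partial_affine v w z i :
  is_derive z (delta_mx 0 i) (fun z : pt => dot v (z - w)) (v 0 i).
Proof.
have -> : (fun z : pt => dot v (z - w)) = dot v \+ cst (- dot v w).
  by apply/funext => y; rewrite /= linearB.
have dv : differentiable (dot v) z.
  by apply: linear_differentiable; exact: dot_continuous.
rewrite -[v 0 i]addr0; apply: is_deriveD; apply: DeriveDef.
  exact: diff_derivable.
by rewrite deriveE// (diff_lin z (@dot_continuous _ _ v)); exact: dot_delta.
Qed.

(** The mean value inequality is applied to u minus its candidate linear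
    approximation, all of whose partial derivatives are small near x. *)
Lemma continuous_partials_differentiable (u : pt -> R) x :
  (\forall z \near x, forall i, derivable u z (delta_mx 0 i)) ->
  (forall i, {for x, continuous (partial i u)}) ->
  differentiable u x.
Proof.
move=> du cu; pose D := partials u x.
suff [] : differentiable u x /\ 'd u x = dot D :> (pt -> R) by [].
apply: approx_differentiable => [||e e0]; [exact: dot_is_linear|exact: dot_continuous|].
have M0 : (0 : R) < m.+1%:R by rewrite ltr0n.
have e'0 : 0 < e / m.+1%:R by rewrite divr_gt0.
have cu' : \forall z \near x, forall i,
    `|partial i u x - partial i u z| <= e / m.+1%:R.
  pose Q (i : 'I_m.+1) := [set z | `|partial i u x - partial i u z| <= e / m.+1%:R].
  have := @filter_forall _ _ Q (nbhs x) _; apply => i.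
  by have /cvgrPdist_le/(_ _ e'0) := cu i.
have [d /= d0 dP] := (nbhs_normP _ _).1 (filterI du cu').
apply/nbhs_normP; exists d => //= z /= zd; rewrite (distrC x z) in zd.
pose w (y : pt) := u y - dot D (y - x).
have -> : u z - u x - dot D (z - x) = w z - w x.
  by rewrite /w subrr linear0 subr0 addrAC.
apply: le_trans (mean_value_partials (c := fun=> e / m.+1%:R) zd _) _.
  move=> y i yd; have xy : `|x - y| < d by rewrite distrC.
  have [/(_ i) dy /(_ i) cy] := dP y xy.
  have dw : is_derive y (delta_mx 0 i) w (partial i u y - D 0 i).
    by apply: is_deriveB; [exact: derivableP|exact: partial_affine].
  split; first exact: (@ex_derive _ _ _ _ _ _ _ dw).
  by rewrite /partial (@derive_val _ _ _ _ _ _ _ dw) mxE distrC.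
rewrite -mulr_sumr -[e in leRHS](divfK (lt0r_neq0 M0)) -[leRHS]mulrA.
rewrite ler_wpM2l ?(ltW e'0)//.
rewrite mulr_natl -[X in _ *+ X](card_ord m.+1) -sumr_const.
by apply: ler_sum => i _; exact: coord_le_norm.
Qed.

Lemma differentiable_partials (u : pt -> R) x : differentiable u x ->
  (forall i, derivable u x (delta_mx 0 i)) /\
  'd u x = dot (partials u x) :> (pt -> R).
Proof.
move=> du; split => [i|]; first exact: diff_derivable.
apply/funext => v; rewrite {1}(matrix_sum_delta v) big_ord1 linear_sum.
by apply: eq_bigr => i _; rewrite linearZ /= mxE /partial deriveE// mulrC.
Qed.

Lemma dot_inj D D' : dot D = dot D' -> D = D'.
Proof. by move=> DD'; apply/rowP => i; rewrite -!dot_delta DD'. Qed.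

Lemma is_derive_big (V : normedModType R) (I : Type) (r : seq I)
    (f : I -> V -> R) (a b : V) :
  (forall i, derivable (f i) a b) ->
  is_derive a b (fun c => \sum_(i <- r) f i c) (\sum_(i <- r) 'D_b (f i) a).
Proof.
move=> df; elim: r => [|i r IH].
  rewrite big_nil (_ : (fun _ => _) = cst 0); first exact: is_derive_cst.
  by apply/funext => y; rewrite big_nil.
rewrite big_cons (_ : (fun _ => _) = f i \+ (fun c => \sum_(j <- r) f j c)).
  by apply: is_deriveD; apply: derivableP.
by apply/funext => y; rewrite big_cons.
Qed.

(** The error is split at a finite set of indices J0.  The terms in J0 are
    treated one by one; by the mean value inequality the increment of any finite
    sum of the other terms is bounded by a small multiple of the distance of z
    from x, because the sums of their gradients are uniformly small. *)
Lemma has_gradient_series (I : choiceType) (T : Type) (G : set_system T)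
    (Y : set T) (t0 : T) (d : R) (f : I -> T -> pt -> R) (F : T -> pt -> R) x S :
  Filter G -> G Y -> Y t0 -> 0 < d ->
  (forall i, has_gradient G (f i) x (partials (f i t0) x)) ->
  (forall i t z j, Y t -> `|z - x| < d -> derivable (f i t) z (delta_mx 0 j)) ->
  small_tails [set q : T * pt | Y q.1 /\ `|q.2 - x| < d]
    (fun i q => `|partials (f i q.1) q.2|) ->
  (forall t z, Y t -> `|z - x| < d -> has_sum (fun i => f i t z : R^o) (F t z)) ->
  has_sum (fun i => partials (f i t0) x) S ->
  has_gradient G F x S.
Proof.
move=> FG GY Yt0 d0 fD df tails sf sS e e0.
have M0 : (0 : R) < m.+1%:R by rewrite ltr0n.
(* The factor m.+1 is lost when the sup norm bounds a dot product. *)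
pose e1 := e / (3 * m.+1%:R).
have e10 : 0 < e1 by rewrite divr_gt0 // mulr_gt0.
have [J0 J0P] := tails e1 e10.
pose e2 := e / (3 * (size J0).+1%:R).
have e20 : 0 < e2 by rewrite divr_gt0 // mulr_gt0// ltr0n.
have fin : \forall t \near G & z \near x, forall i, i \in (J0 : seq I) ->
    `|f i t z - f i t x - dot (partials (f i t0) x) (z - x)| <= e2 * `|z - x|.
  elim: (J0 : seq I) => [|i r IH]; first by apply: filterE.
  apply: filterS2 (fD i e2 e20) IH => -[t z] /= h1 h2 j.
  by rewrite inE => /orP[/eqP ->//|]; exact: h2.
have dom : \forall t \near G & z \near x, Y t /\ `|z - x| < d.
  have xd : \forall z \near x, `|z - x| < d.
    by apply/nbhs_normP; exists d => //= z /=; rewrite distrC.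
  by exists (Y, [set z | `|z - x| < d]).
apply: filterS2 fin dom => -[t z] /= fin [Yt zd].
have head : `|F t z - F t x - \sum_(i <- J0) (f i t z - f i t x)|
    <= e1 * m.+1%:R * `|z - x|.
  apply: (@has_sum_tail R I R^o).
    have xd : `|x - x| < d by rewrite subrr normr0.
    rewrite /has_sum (_ : partial_sum _ = partial_sum (fun i => f i t z : R^o)
      \- partial_sum (fun i => f i t x : R^o)).
      exact: cvgB (sf _ _ _ _) (sf _ _ _ _).
    by apply/funext => J; rewrite /= !partial_sumE sumrB.
  move=> L LJ0; rewrite sumrB.
  apply: le_trans (mean_value_partials
    (u := fun y => \sum_(i <- L) f i t y) (c := fun=> e1) zd _) _.
    move=> y j yd; have dL := is_derive_big L (fun i => df i t y j Yt yd).
    split; first exact: (@ex_derive _ _ _ _ _ _ _ dL).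
    rewrite /partial (@derive_val _ _ _ _ _ _ _ dL).
    apply: le_trans (ler_norm_sum _ _ _) _.
    apply: le_trans (J0P L LJ0 (t, y) (conj Yt yd)).
    apply: ler_sum => i _ /=.
    by apply: le_trans (coord_le_norm _ j); rewrite mxE.
  rewrite -mulr_sumr -mulrA ler_wpM2l ?(ltW e10)//.
  rewrite mulr_natl -[X in _ *+ X](card_ord m.+1) -sumr_const.
  by apply: ler_sum => i _; exact: coord_le_norm.
have tailS : `|S - \sum_(i <- J0) partials (f i t0) x| <= e1.
  apply: has_sum_tail => // L LJ0; apply: le_trans (ler_norm_sum _ _ _) _.
  apply: (J0P L LJ0 (t0, x)); split => //=; by rewrite subrr normr0.
set h := z - x in head fin *.
have -> : F t z - F t x - dot S h =
   (F t z - F t x - \sum_(i <- J0) (f i t z - f i t x)) +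
   \sum_(i <- J0) (f i t z - f i t x - dot (partials (f i t0) x) h) -
   dot (S - \sum_(i <- J0) partials (f i t0) x) h.
  have -> : \sum_(i <- J0) (f i t z - f i t x - dot (partials (f i t0) x) h) =
      \sum_(i <- J0) (f i t z - f i t x) - \sum_(i <- J0) dot (partials (f i t0) x) h.
    by rewrite -sumrB.
  by rewrite dotBl dot_suml; ring.
have e1M : e1 * m.+1%:R = e / 3.
  by rewrite /e1 invfM mulrA divfK ?gt_eqF.
have b1 : `|dot (S - \sum_(i <- J0) partials (f i t0) x) h| <= e / 3 * `|h|.
  apply: le_trans (dot_le_norm _ _) _.
  by rewrite -e1M [e1 * _]mulrC ler_wpM2r// ler_wpM2l.
have b2 : `|\sum_(i <- J0) (f i t z - f i t x - dot (partials (f i t0) x) h)|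
    <= e / 3 * `|h|.
  apply: le_trans (ler_norm_sum _ _ _) _.
  apply: (@le_trans _ _ (\sum_(i <- J0) e2 * `|h|)).
    rewrite !big_seq; apply: ler_sum => i iJ0; exact: fin.
  rewrite big_const_seq count_predT iter_addr_0 -[_ *+ _]mulr_natl mulrA.
  rewrite ler_wpM2r//.
  apply: (@le_trans _ _ ((size J0).+1%:R * e2)).
    by rewrite ler_wpM2r ?(ltW e20)// ler_nat.
  have n0 : (size J0).+1%:R != 0 :> R by rewrite pnatr_eq0.
  rewrite le_eqVlt; apply/orP; left; apply/eqP.
  by rewrite /e2; move: n0; set n := _%:R => n0; field.
rewrite e1M in head.
apply: le_trans (ler_normB _ _) _; apply: le_trans (lerD (ler_normD _ _) (lexx _)) _.
move: head b1 b2; set a := `|_|; set b := `|_|; set c := `|_|.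
set k := `|h|; rewrite -[e * k](_ : e / 3 * k + e / 3 * k + e / 3 * k = _); last by field.
by move=> *; rewrite !lerD.
Qed.

End gradients.

(** * The distance functions of the two model spaces *)

Section hyperbolic_functions.
Variable R : realType.
Implicit Types s t : R.

Definition cosh s : R := (expR s + expR (- s)) / 2.
Definition sinh s : R := (expR s - expR (- s)) / 2.

Lemma cosh2B s : cosh s ^+ 2 - 1 = sinh s ^+ 2.
Proof.
have e0 := expR_gt0 s; rewrite /cosh /sinh expRN.
by move: (expR s) e0 => u u0; field; rewrite gt_eqF.
Qed.

Lemma sinh_ge0 s : 0 <= s -> 0 <= sinh s.
Proof.
by move=> s0; rewrite divr_ge0// subr_ge0 ler_expR; lra.
Qed.

Lemma sinh_gt0 s : 0 < s -> 0 < sinh s.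
Proof.
by move=> s0; rewrite divr_gt0// subr_gt0 ltr_expR; lra.
Qed.

Lemma cosh_half s : cosh s - 1 = 2 * sinh (s / 2) ^+ 2.
Proof.
have -> : cosh s = cosh (s / 2 + s / 2) by rewrite -splitr.
rewrite /cosh /sinh opprD !expRD !expRN.
by have := expR_gt0 (s / 2); move: (expR _) => u u0; field; rewrite gt_eqF.
Qed.

(** As cosh and sinh are the half sum and half difference of the two
    exponentials, cosh s + sinh s = exp s. *)
Lemma arcosh_cosh s : 0 <= s -> arcosh (cosh s) = s.
Proof.
move=> s0; rewrite /arcosh cosh2B sqrtr_sqr ger0_norm ?sinh_ge0//.
by rewrite (_ : _ + _ = expR s) ?expRK// /cosh /sinh; field.
Qed.

Lemma arcosh_arg_gt0 t : 1 <= t -> 0 < t + Num.sqrt (t ^+ 2 - 1).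
Proof. by move=> t1; have := sqrtr_ge0 (t ^+ 2 - 1); lra. Qed.

Lemma cosh_arcosh t : 1 <= t -> cosh (arcosh t) = t.
Proof.
move=> t1; have w0 := arcosh_arg_gt0 t1.
have t20 : 0 <= t ^+ 2 - 1 by nra.
rewrite /cosh expRN lnK ?posrE//; have := sqr_sqrtr t20.
move: w0; move: (Num.sqrt _) => r w0 r2.
have -> : (t + r)^-1 = t - r.
  apply: (mulfI (lt0r_neq0 w0)); rewrite mulfV ?gt_eqF//.
  by rewrite mulrC -subr_sqr r2; ring.
by field.
Qed.

Lemma arcosh_ge0 t : 1 <= t -> 0 <= arcosh t.
Proof.
by move=> t1; apply: ln_ge0; have := sqrtr_ge0 (t ^+ 2 - 1); lra.
Qed.

Lemma is_derive_arcosh t : 1 < t ->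
  is_derive t 1 (@arcosh R) (Num.sqrt (t ^+ 2 - 1))^-1.
Proof.
move=> t1; have t20 : 0 < t ^+ 2 - 1 by nra.
have w0 := arcosh_arg_gt0 (ltW t1).
have d1 : is_derive t 1 (fun u : R => u ^+ 2 - 1) (2 * t).
  by apply: is_derive_eq; rewrite subr0 [t *: 1]mulr1 mulr_natl.
have d2 := @is_derive1_comp R Num.sqrt (fun u => u ^+ 2 - 1) t _ _
  (is_derive1_sqrt t20) d1.
have d3 : is_derive t 1 (fun u => u + Num.sqrt (u ^+ 2 - 1))
  (1 + (2 * Num.sqrt (t ^+ 2 - 1))^-1 * (2 * t)).
  by apply: is_deriveD.
have := @is_derive1_comp R (@ln R) (fun u => u + Num.sqrt (u ^+ 2 - 1)) t _ _
  (is_derive1_ln w0) d3.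
rewrite (_ : @ln R \o _ = @arcosh R)// => d4; apply: is_derive_eq.
have r0 : Num.sqrt (t ^+ 2 - 1) > 0 by rewrite sqrtr_gt0.
move: w0 r0; move: (Num.sqrt _) => r w0 r0.
by field; rewrite !gt_eqF.
Qed.

End hyperbolic_functions.

Section distance_gradient.
Variables (R : realType) (m : nat).
Local Notation pt := 'rV[R]_m.+1.
Implicit Types (g : geometry) (x y z p v w : pt).

Definition gradient_at (u : pt -> R) x D : Prop :=
  differentiable u x /\ 'd u x = dot D :> (pt -> R).

Lemma gradient_at_partials u x D : gradient_at u x D -> partials u x = D.
Proof.
by move=> [du duD]; apply: dot_inj; have [_ <-] := differentiable_partials du.
Qed.

Lemma gradient_at_comp (f : R -> R) (u : pt -> R) x (a : R) D :
  is_derive (u x) 1 f a -> gradient_at u x D -> gradient_at (f \o u) x (a *: D).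
Proof.
move=> fa [du duD]; have df : differentiable f (u x) by apply/derivable1_diffP.
split; first exact: differentiable_comp.
rewrite diff_comp// duD diff1E// derive1E (@derive_val _ _ _ _ _ _ _ fa).
by apply/funext => v /=; rewrite dotZl mulrC.
Qed.

Lemma gradient_atM (u w : pt -> R) x D E :
  gradient_at u x D -> gradient_at w x E ->
  gradient_at (fun z => u z * w z) x (u x *: E + w x *: D).
Proof.
move=> [du duD] [dw dwE].
have [duw duwE] := is_diffM (DiffDef _ du duD) (DiffDef _ dw dwE).
split; first exact: duw.
apply: (etrans duwE); apply/funext => v.
rewrite dotDl !dotZl.
by [].
Qed.

Lemma enorm_sqr v : enorm v ^+ 2 = dot v v.
Proof. by rewrite sqr_sqrtr// dot_ge0. Qed.

Lemma enorm0 : enorm (0 : pt) = 0.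
Proof. by rewrite /enorm linear0 sqrtr0. Qed.

(** Taylor expansion at x of the squared distance to p. *)
Lemma dot_sub_sqr x z p :
  dot (z - p) (z - p) =
  dot (x - p) (x - p) + dot (2 *: (x - p)) (z - x) + dot (z - x) (z - x).
Proof.
have -> : z - p = (x - p) + (z - x) by rewrite [RHS]addrC subrKA.
move: (x - p) (z - x) => a b; rewrite dotZl dotDl dotC dotDl (dotC b (a + b)) dotDl.
by rewrite (dotC b a); ring.
Qed.

Lemma gradient_sqr_dist x p :
  gradient_at (fun z => dot (z - p) (z - p)) x (2 *: (x - p)).
Proof.
apply: approx_differentiable => [||e e0].
- exact: dot_is_linear.
- exact: dot_continuous.
have M0 : (0 : R) < m.+1%:R by rewrite ltr0n.
apply/nbhs_normP; exists (e / m.+1%:R) => /=; first by rewrite divr_gt0.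
move=> z /= zx; rewrite (distrC x z) ltr_pdivlMr// in zx.
rewrite (dot_sub_sqr x z p) (_ : _ - _ - _ = dot (z - x) (z - x)); last by ring.
apply: le_trans (dot_le_norm _ _) _; rewrite ler_wpM2r// mulrC; exact: ltW.
Qed.

Lemma heightE : @height R m = dot (delta_mx 0 ord_max).
Proof. by apply/funext => z; rewrite dotC dot_delta. Qed.

Lemma heightB x y : height (x - y) = height x - height y.
Proof. by rewrite /height !mxE. Qed.

(** The argument of arcosh in the hyperbolic distance: a rational function, more
    convenient than the distance itself. *)
Definition cosh_dist p x : R :=
  1 + enorm (x - p) ^+ 2 / (2 * height x * height p).

Lemma gradient_cosh_dist x p : 0 < height x -> 0 < height p ->
  gradient_at (cosh_dist p) x ((height x * height p)^-1 *:
    ((x - p) - (height p * (cosh_dist p x - 1)) *: delta_mx 0 ord_max)).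
Proof.
move=> hx hp.
have gh : gradient_at (@height R m) x (delta_mx 0 ord_max).
  split; first exact: differentiable_coord.
  rewrite heightE; apply: (diff_lin x); exact: dot_continuous.
have dV : is_derive (height x) 1 (fun t : R => t^-1) (- (height x) ^- 2).
  have := is_deriveV (lt0r_neq0 hx : id (height x) != 0) (is_derive_id (height x) 1).
  by rewrite [_ *: 1]mulr1.
have gV := gradient_at_comp dV gh.
have gM := gradient_atM (gradient_sqr_dist x p) gV.
have da : is_derive ((dot (x - p) (x - p) * (height x)^-1) : R) 1
    (fun t : R => 1 + (2 * height p)^-1 * t) (2 * height p)^-1.
  by apply: is_derive_eq; rewrite add0r mul1r [_ *: 1]mulr1.
have := gradient_at_comp (u := fun z => dot (z - p) (z - p) * (height z)^-1) da gM.
congr gradient_at.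
  by apply/funext => z /=; rewrite /cosh_dist enorm_sqr !invfM; ring.
rewrite /cosh_dist enorm_sqr; apply/rowP => i; rewrite !mxE /GRing.scale /=.
by field; rewrite !gt_eqF.
Qed.

(** The metric is [conformal_factor g x ^- 2] times the Euclidean one at x. *)
Definition conformal_factor g x : R :=
  match g with Hyperbolic => height x | Flat => 1 end.

Lemma conformal_factor_gt0 g x : model_space g x -> 0 < conformal_factor g x.
Proof. by case: g. Qed.

Lemma dot_gt0 v : v != 0 -> 0 < dot v v.
Proof.
move=> v0; rewrite lt_neqAle dot_ge0 andbT; apply: contraNneq v0 => v0.
by apply/eqP/dot_eq0.
Qed.

Lemma cosh_dist_gt1 x p : 0 < height x -> 0 < height p -> x != p ->
  1 < cosh_dist p x.
Proof.
move=> hx hp xp; rewrite /cosh_dist enorm_sqr ltrDl.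
by rewrite divr_gt0 ?mulr_gt0// dot_gt0// subr_eq0.
Qed.

Lemma cosh_dist_ge1 x p : 0 < height x -> 0 < height p -> 1 <= cosh_dist p x.
Proof.
by move=> hx hp; rewrite lerDl divr_ge0 ?sqr_ge0// !mulr_ge0// ltW.
Qed.

Lemma cosh_distK x p : 0 < height x -> 0 < height p ->
  cosh (dist Hyperbolic x p) = cosh_dist p x.
Proof. by move=> hx hp; rewrite cosh_arcosh// cosh_dist_ge1. Qed.

Lemma distC g x y : dist g x y = dist g y x.
Proof.
have xy : enorm (x - y) = enorm (y - x).
  by rewrite /enorm -opprB dotNl dotC dotNl opprK.
by case: g => /=; rewrite xy// (mulrAC 2).
Qed.

Lemma dist_ge0 g x y : model_space g x -> model_space g y -> 0 <= dist g x y.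
Proof.
case: g => /= [hx hy|_ _]; last exact: sqrtr_ge0.
by apply: arcosh_ge0; exact: cosh_dist_ge1.
Qed.

Lemma distxx g x : dist g x x = 0.
Proof.
case: g => /=; rewrite subrr enorm0//.
by rewrite expr0n /= mul0r addr0 /arcosh expr1n subrr sqrtr0 addr0 ln1.
Qed.

Lemma dot_sqrB v w b :
  dot (v - b *: w) (v - b *: w) = dot v v - 2 * b * dot v w + b ^+ 2 * dot w w.
Proof.
rewrite dotBl (dotC v) dotBl (dotC (b *: w) (v - _)) dotBl !(dotC v (b *: w)).
by rewrite !dotZl (dotC w (b *: w)) dotZl (dotC w v); ring.
Qed.

Lemma dot_sqrZ v b : dot (b *: v) (b *: v) = b ^+ 2 * dot v v.
Proof. by rewrite dotZl dotC dotZl mulrA expr2. Qed.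

(** The eikonal equation: the gradient of the distance has Riemannian norm one.
    For a metric that is c^-2 times the Euclidean one, the squared Riemannian norm
    of the gradient is c^2 times the squared Euclidean norm of G. *)
Lemma gradient_dist g x p : model_space g x -> model_space g p -> x != p ->
  exists2 G, gradient_at (fun z => dist g z p) x G
    & conformal_factor g x ^+ 2 * dot G G = 1.
Proof.
case: g => /= [hx hp xp|_ _ xp].
  have q1 := cosh_dist_gt1 hx hp xp.
  have gq := gradient_cosh_dist hx hp.
  have := gradient_at_comp (is_derive_arcosh q1) gq.
  set G := _ *: _ => gG; exists G => //.
  have q20 : 0 < cosh_dist p x ^+ 2 - 1 by nra.
  have xpE : dot (x - p) (x - p) = 2 * height x * height p * (cosh_dist p x - 1).
    rewrite (_ : cosh_dist p x - 1 = dot (x - p) (x - p) / (2 * height x * height p)).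
      by field; rewrite !gt_eqF.
    by rewrite /cosh_dist enorm_sqr addrAC subrr add0r.
  have eE v : dot v (delta_mx 0 ord_max) = height v by rewrite dot_delta.
  have e1 : dot (delta_mx 0 ord_max : pt) (delta_mx 0 ord_max) = 1.
    by rewrite eE /height mxE !eqxx.
  rewrite /G !dot_sqrZ dot_sqrB e1 eE heightB xpE exprVn sqr_sqrtr ?(ltW q20)//.
  by field; rewrite !gt_eqF.
have D0 : 0 < dot (x - p) (x - p) by rewrite dot_gt0// subr_eq0.
have := gradient_at_comp (u := fun z => dot (z - p) (z - p))
  (is_derive1_sqrt D0) (gradient_sqr_dist x p).
set G := _ *: _ => gG; exists G => //.
rewrite /G !dot_sqrZ expr1n mul1r exprVn exprMn sqr_sqrtr ?(ltW D0)//.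
by move: D0; move: (dot _ _) => D D0; field; rewrite gt_eqF.
Qed.

End distance_gradient.

(** * Geodesics and their end velocities *)

Section geodesics.
Variables (R : realType) (m : nat).
Local Notation pt := 'rV[R]_m.+1.
Implicit Types (g : geometry) (x y z p v w : pt).

Lemma dist_gt0 g x p : model_space g x -> model_space g p -> x != p ->
  0 < dist g x p.
Proof.
move=> Xx Xp xp; rewrite lt_neqAle dist_ge0// andbT eq_sym.
apply/eqP => d0; case: g Xx Xp d0 => /= [hx hp d0|_ _ /eqP].
  have := cosh_dist_gt1 hx hp xp; rewrite -cosh_distK//= d0 /cosh oppr0 expR0.
  by move=> h; lra.
by rewrite sqrtr_eq0 leNgt dot_gt0// subr_eq0.
Qed.

(** For the hyperboloid model: the vectors with coefficients sinh (d - s) / sinh d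
    and sinh s / sinh d on two points at distance d form a curve parametrized by
    arc length. *)
Lemma sinh_cosh_geodesic (d s t : R) :
  sinh (d - s) * sinh (d - t) + sinh s * sinh t +
  (sinh (d - s) * sinh t + sinh s * sinh (d - t)) * cosh d =
  sinh d ^+ 2 * cosh (s - t).
Proof.
rewrite /cosh /sinh !opprD !opprK !expRD !expRN.
have := expR_gt0 d; have := expR_gt0 s; have := expR_gt0 t.
by move: (expR d) (expR s) (expR t) => a b c *; field; rewrite !gt_eqF.
Qed.

(** A point of the half-space with height h and horizontal part u has linear
    coordinates 1/h and u/h in the hyperboloid model, which determine it.
    Combining p and x linearly with coefficients a and b in these coordinates
    gives the point below; the multiple of the last basis vector corrects its
    height, since the full vectors p and x contribute a + b instead of 1. *)
Definition hyperboloid_comb p x (a b : R) : pt :=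
  (a / height p + b / height x)^-1 *:
  ((a / height p) *: p + (b / height x) *: x +
   (1 - a - b) *: delta_mx 0 ord_max).

Lemma height_comb p x a b : 0 < height p -> 0 < height x ->
  height (hyperboloid_comb p x a b) = (a / height p + b / height x)^-1.
Proof.
move=> hp hx; rewrite /hyperboloid_comb {1}/height !mxE -!/(height _) !eqxx /=.
by rewrite !divfK ?gt_eqF//; ring.
Qed.

Lemma dot_comb3 p x e (u v w : R) : dot e e = 1 ->
  dot (u *: p + v *: x + w *: e) (u *: p + v *: x + w *: e) =
  u ^+ 2 * dot p p + v ^+ 2 * dot x x + w ^+ 2 + 2 * u * v * dot p x +
  2 * u * w * dot p e + 2 * v * w * dot x e.
Proof.
move=> e1; set y := u *: p + v *: x + w *: e; rewrite {1}/y !dotDl !dotZl.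
rewrite !(dotC _ y) /y !dotDl !dotZl e1 (dotC x p) (dotC e p) (dotC e x); ring.
Qed.

(** In the hyperboloid model the hyperbolic cosine of the distance is bilinear,
    and the two hypotheses on a, b, a', b' say that the combinations have norm
    one, that is, lie on the hyperboloid. *)
Lemma cosh_dist_comb p x a b a' b' : 0 < height p -> 0 < height x ->
  0 < a / height p + b / height x -> 0 < a' / height p + b' / height x ->
  a ^+ 2 + b ^+ 2 + 2 * a * b * cosh_dist p x = 1 ->
  a' ^+ 2 + b' ^+ 2 + 2 * a' * b' * cosh_dist p x = 1 ->
  cosh_dist (hyperboloid_comb p x a' b') (hyperboloid_comb p x a b) =
  a * a' + b * b' + (a * b' + a' * b) * cosh_dist p x.
Proof.
move=> hp hx h0 h0' ab1 ab1'.
have eE v : dot v (delta_mx 0 ord_max) = height v by rewrite dot_delta.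
have e1 : dot (delta_mx 0 ord_max : pt) (delta_mx 0 ord_max) = 1.
  by rewrite eE /height mxE !eqxx.
rewrite {1}/cosh_dist !height_comb// enorm_sqr.
have -> : hyperboloid_comb p x a b - hyperboloid_comb p x a' b' =
  ((a / height p + b / height x)^-1 * (a / height p)
   - (a' / height p + b' / height x)^-1 * (a' / height p)) *: p +
  ((a / height p + b / height x)^-1 * (b / height x)
   - (a' / height p + b' / height x)^-1 * (b' / height x)) *: x +
  ((a / height p + b / height x)^-1 * (1 - a - b)
   - (a' / height p + b' / height x)^-1 * (1 - a' - b')) *: delta_mx 0 ord_max.
  by apply/rowP => i; rewrite !mxE; ring.
rewrite (dot_comb3 _ _ _ _ _ e1) !eE.
have pxE : dot p x = (dot p p + dot x x) / 2 -
    height p * height x * (cosh_dist p x - 1).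
  rewrite /cosh_dist enorm_sqr addrAC subrr add0r dotBl (dotC _ (x - p)) (dotC _ (x - p)).
  rewrite !dotBl (dotC p x).
  move: (dot x x) (dot x p) (dot p p) => X Q P; field; rewrite !gt_eqF//.
rewrite pxE; move: (cosh_dist p x) ab1 ab1' => q ab1 ab1'.
move: (height p) (height x) (dot p p) (dot x x) hp hx h0 h0' => hp hx P X hp0 hx0 h0 h0'.
set al := (a / hp + b / hx) in h0 *; set al' := (a' / hp + b' / hx) in h0' *.
(* The difference of the two sides is a combination of the two norm
   conditions; the coefficients come from the expansion of the squared chord in
   the inverses of al and al'. *)
apply/eqP; rewrite -subr_eq0; apply/eqP.
transitivity (- (al / al' * (a' ^+ 2 + b' ^+ 2 + 2 * a' * b' * q - 1) +
                al' / al * (a ^+ 2 + b ^+ 2 + 2 * a * b * q - 1)) / 2); last first.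
  by rewrite ab1 ab1' subrr; ring.
rewrite /al /al'.
have k1 : a * hx + b * hp != 0.
  have : al * (hp * hx) != 0 by rewrite !mulf_neq0 ?gt_eqF.
  by rewrite (_ : _ * _ = a * hx + b * hp)// /al; field; rewrite !gt_eqF.
have k2 : a' * hx + b' * hp != 0.
  have : al' * (hp * hx) != 0 by rewrite !mulf_neq0 ?gt_eqF.
  by rewrite (_ : _ * _ = a' * hx + b' * hp)// /al'; field; rewrite !gt_eqF.
field; rewrite k1 k2 !gt_eqF//.
Qed.

Lemma coshN (s : R) : cosh (- s) = cosh s.
Proof. by rewrite /cosh opprK addrC. Qed.

Lemma cosh_norm (s : R) : cosh `|s| = cosh s.
Proof. by case: (leP 0 s) => [/ger0_norm ->|/ltr0_norm ->]; rewrite ?coshN. Qed.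

Lemma derivable_comb p x (a b : R -> R) s : 0 < height p -> 0 < height x ->
  derivable a s 1 -> derivable b s 1 -> a s / height p + b s / height x != 0 ->
  derivable (fun t => hyperboloid_comb p x (a t) (b t)) s 1.
Proof.
move=> hp hx da db ab0; apply/derivable_mxP => i j.
pose u : R -> R := (height p)^-1 *: a + (height x)^-1 *: b.
have du : derivable u s 1 by apply: derivableD; exact: derivableZ.
have uE t : u t = a t / height p + b t / height x.
  rewrite -[LHS]/((height p)^-1 * a t + (height x)^-1 * b t).
  by rewrite (mulrC (height p)^-1) (mulrC (height x)^-1).
have us : u s != 0 by rewrite uE.
pose e : R := (delta_mx 0 ord_max : pt) i j.
pose w : R -> R := (p i j / height p - e) *: a + (x i j / height x - e) *: b + cst e.
have dw : derivable w s 1 := derivableD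
  (derivableD (derivableZ (k := p i j / height p - e) da)
    (derivableZ (k := x i j / height x - e) db)) (derivable_cst e _ _).
have dV : derivable (fun t => (u t)^-1) s 1 := derivableV us du.
have wE t : w t = (p i j / height p - e) * a t + (x i j / height x - e) * b t + e by [].
have -> : (fun t => hyperboloid_comb p x (a t) (b t) i j) = (fun t => (u t)^-1) * w.
  apply/funext => t; transitivity ((u t)^-1 * w t); last by [].
  by rewrite uE wE /e !mxE; congr (_^-1 * _); ring.
exact: (@derivableM _ _ _ _ _ _ dV dw).
Qed.

(** In the flat case the geodesic is the segment.  In the hyperbolic case it is
    the image of the hyperboloid geodesic, with coefficients
    sinh (d - s) / sinh d and sinh s / sinh d at time s. *)
Lemma end_velocity_exists g p x : model_space g x -> model_space g p -> x != p ->
  exists v, is_end_velocity g p x v.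
Proof.
move=> Xx Xp xp; have := dist_gt0 Xp Xx; rewrite eq_sym => /(_ xp).
case: g Xx Xp => /= [hx hp|_ _]; last first.
  rewrite -/(dist Flat p x); set d := dist Flat p x => d0.
  exists (d^-1 *: (x - p)); exists (fun s => p + (s / d) *: (x - p)).
    split; first by rewrite mul0r scale0r addr0.
      by rewrite -/d mulfV ?gt_eqF// scale1r addrC subrK.
    move=> s t _ _; split => //.
    rewrite /= opprD addrACA subrr add0r -scalerBl -mulrBl.
    rewrite /enorm dot_sqrZ sqrtrM ?sqr_ge0// sqrtr_sqr normrM normfV (gtr0_norm d0).
    rewrite -mulrA (_ : d^-1 * _ = 1) ?mulr1//.
    by rewrite -[X in _ * X]/(dist Flat x p) distC mulVf// gt_eqF.
  apply: cvg_near_cst; near=> s.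
  have s0 : s != 0 by rewrite gt_eqF//; near: s; exact: nbhs_right_gt.
  rewrite -/(dist Flat p x) -/d opprD addrACA subrr add0r -scalerBl -mulrBl.
  by rewrite opprB addrC subrK scalerA mulrA mulVf// mul1r.
rewrite -/(dist Hyperbolic p x); set d := dist Hyperbolic p x => d0.
have sd0 := sinh_gt0 d0.
pose A (s : R) := sinh (d - s) / sinh d; pose B (s : R) := sinh s / sinh d.
pose c (s : R) := hyperboloid_comb p x (A s) (B s).
have A0 : A 0 = 1 by rewrite /A subr0 mulfV ?gt_eqF.
have sinh0 : sinh (0 : R) = 0 by rewrite /sinh oppr0 subrr mul0r.
have B0 : B 0 = 0 by rewrite /B sinh0 mul0r.
have Ad : A d = 0 by rewrite /A subrr sinh0 mul0r.
have Bd : B d = 1 by rewrite /B mulfV ?gt_eqF.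
have c0 : c 0 = p.
  rewrite /c A0 B0 /hyperboloid_comb !mul0r addr0 scale0r addr0 subr0 subrr.
  by rewrite scale0r addr0 scalerA mul1r mulVf ?scale1r// invr_eq0 gt_eqF.
have cd : c d = x.
  rewrite /c Ad Bd /hyperboloid_comb !mul0r add0r scale0r add0r subr0 subrr.
  by rewrite scale0r addr0 scalerA mul1r mulVf ?scale1r// invr_eq0 gt_eqF.
have AB0 s : 0 <= s <= d -> 0 < A s / height p + B s / height x.
  move=> /andP[s0 sd].
  have a0 : 0 <= A s by rewrite divr_ge0 ?sinh_ge0 ?subr_ge0// ltW.
  have [->|s1] := eqVneq s 0.
    by rewrite A0 B0 mul0r addr0 mul1r invr_gt0.
  have b0 : 0 < B s by rewrite divr_gt0// sinh_gt0// lt_neqAle eq_sym s1.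
  by apply: ltr_wpDl; [rewrite divr_ge0// ltW|rewrite divr_gt0].
have qE : cosh_dist p x = cosh d by rewrite /d distC cosh_distK.
have AB s t : A s * A t + B s * B t + (A s * B t + A t * B s) * cosh_dist p x =
    cosh (s - t).
  have := sinh_cosh_geodesic d s t; rewrite qE /A /B.
  move: (sinh d) sd0 (cosh d) (cosh (s - t)) => r r0 q k h.
  apply: (mulfI (x := r ^+ 2)); first by rewrite expf_neq0// gt_eqF.
  by rewrite -h; field; rewrite gt_eqF.
have AB1 s : A s ^+ 2 + B s ^+ 2 + 2 * A s * B s * cosh_dist p x = 1.
  have := AB s s; rewrite subrr /cosh oppr0 expR0 => h.
  by transitivity ((1 + 1) / 2 : R); [rewrite -h; ring|field].
have Xc s : 0 <= s <= d -> 0 < height (c s).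
  by move=> /AB0 ab; rewrite height_comb// invr_gt0.
have df : derivable (fun t => c (d - t)) 0 1.
  apply: (derivable_comb (a := fun t => A (d - t)) (b := fun t => B (d - t))) => //.
  by rewrite subr0 gt_eqF// AB0// lexx ltW.
have [l dl] := (cvg_ex _).1 df.
exists (- l); exists c.
  split => //; rewrite -/d => s t.
  rewrite !in_itv /= => sd td; split; first exact: Xc.
  rewrite -[LHS]/(arcosh (cosh_dist (c t) (c s))) cosh_dist_comb ?AB0//.
  by rewrite AB -cosh_norm arcosh_cosh.
have := cvgN (cvg_dnbhs_at_right dl) => /(_ _); apply: cvg_trans.
apply: near_eq_cvg; near=> s => /=.
rewrite -/(dist Hyperbolic p x) -/d.
rewrite -[LHS]/(- (s^-1 *: (c (d - (s *: 1 + 0)) - c (d - 0)))).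
by rewrite addr0 [s *: 1]mulr1 subr0 -scalerN opprB.
Unshelve. all: by end_near. Qed.

End geodesics.


Section end_velocities.
Variables (R : realType) (m : nat).
Local Notation pt := 'rV[R]_m.+1.
Implicit Types (g : geometry) (x y z p v w : pt).

Lemma sinh_half_cvg : s^-1 * (2 * sinh (s / 2)) @[s --> 0^'+] --> (1 : R).
Proof.
have d1 : is_derive (0 : R) 1 (fun s : R => s / 2) 2^-1.
  by apply: is_derive_eq; rewrite ?scaler0 ?add0r ?addr0 ?[_ *: 1]mulr1 ?mul1r.
have d2 : is_derive (0 : R) 1 (fun s : R => - (s / 2)) (- 2^-1).
  exact: (is_deriveN d1).
have d3 := @is_derive1_comp R expR (fun s => s / 2) 0 _ _ (is_derive_expR _) d1.
have d4 := @is_derive1_comp R expR (fun s => - (s / 2)) 0 _ _ (is_derive_expR _) d2.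
have d5 : is_derive (0 : R) 1 (fun s : R => 2 * sinh (s / 2)) 1.
  have := is_deriveB d3 d4; rewrite !mul0r oppr0 expR0 !mul1r opprK.
  rewrite (_ : 2^-1 + 2^-1 = 1 :> R); last by field.
  congr is_derive; apply/funext => s; rewrite /sinh mulrCA mulfV ?mulr1//.
have [/cvg_ex[l dl] dE] := d5.
have l1 : l = 1 by rewrite -dE; apply/esym/cvg_lim.
rewrite l1 in dl; have := cvg_dnbhs_at_right dl; apply: cvg_trans.
apply: near_eq_cvg; apply: nearW => s /=.
by rewrite addr0 [s *: 1]mulr1 mul0r {2}/sinh oppr0 subrr mul0r mulr0 subr0.
Qed.

Lemma geodesic_end_cvg g p x v c :
  c (dist g p x) = x ->
  s^-1 *: (c (dist g p x) - c (dist g p x - s)) @[s --> (0 : R)^'+] --> v ->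
  c (dist g p x - s) @[s --> (0 : R)^'+] --> x.
Proof.
move=> cx cv; set d := dist g p x in cx cv *.
have s0 : s @[s --> (0 : R)^'+] --> (0 : R).
  exact: cvg_within.
have xF : (fun=> x) @ (0 : R)^'+ --> x by exact: cvg_cst.
have := cvgB xF (cvgZ s0 cv); rewrite scale0r subr0 => /(_ _ _) h.
apply: (cvg_trans _ h); apply: near_eq_cvg; near=> s => /=.
have s1 : 0 < s by near: s; exact: nbhs_right_gt.
rewrite -[LHS]/(x - s *: (s^-1 *: (c d - c (d - s)))).
by rewrite scalerA mulfV ?gt_eqF// scale1r cx opprB addrC subrK.
Unshelve. all: by end_near. Qed.

Lemma geodesic_chord g p x c s : model_space g x -> model_space g p ->
  geodesic_segment g p x c -> 0 <= s <= dist g p x ->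
  [/\ model_space g (c (dist g p x - s)), dist g x (c (dist g p x - s)) = s
    & dist g (c (dist g p x - s)) p = dist g p x - s].
Proof.
move=> Xx Xp [c0 cd iso] /andP[s0 sd]; set d := dist g p x in c0 cd iso sd *.
have d0 : 0 <= d by exact: dist_ge0.
have i1 : d - s \in `[0, d] by rewrite in_itv /=; lra.
have i2 : d \in `[0, d] by rewrite in_itv /=; lra.
have i3 : 0 \in `[0, d] by rewrite in_itv /=; lra.
have [Xc cx] := iso _ _ i1 i2; have [_ cp] := iso _ _ i1 i3.
split=> //.
  by rewrite -{1}cd distC cx distrC opprB addrC subrK ger0_norm.
by rewrite -c0 cp subr0 ger0_norm// subr_ge0.
Qed.

(** The half-angle formula cosh d - 1 = 2 sinh(d/2)^2, solved for the Euclidean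
    distance. *)
Lemma sqr_chord g x w : model_space g x -> model_space g w ->
  dot (x - w) (x - w) =
  match g with
  | Hyperbolic => height x * height w * (2 * sinh (dist g x w / 2)) ^+ 2
  | Flat => dist g x w ^+ 2
  end.
Proof.
case: g => /= [hx hw|_ _]; last by rewrite enorm_sqr.
have := cosh_half (dist Hyperbolic x w); rewrite (cosh_distK hx hw) /=.
move: (sinh _) => u; rewrite /cosh_dist addrAC subrr add0r enorm_sqr exprMn.
move: (dot _ _) => D /(congr1 (fun t => t * (2 * height x * height w))).
by rewrite divfK ?mulf_neq0 ?gt_eqF// => ->; ring.
Qed.

(** The end velocity has Riemannian norm one, because the chord of an arc of
    length s has Riemannian length s to first order. *)
Lemma end_velocity_norm g p x v : model_space g x -> model_space g p -> x != p ->
  is_end_velocity g p x v -> dot v v = conformal_factor g x ^+ 2.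
Proof.
move=> Xx Xp xp [c geo cv]; have [c0 cx _] := geo.
have d0 : 0 < dist g p x by rewrite distC dist_gt0.
have wx := geodesic_end_cvg cx cv.
set d := dist g p x in d0 cv cx c0 wx.
have sq_cont : {for v, continuous (fun z : pt => dot (z - 0) (z - 0))}.
  by apply: differentiable_continuous; have [] := gradient_sqr_dist v 0.
have lim1 : dot (s^-1 *: (c d - c (d - s)) - 0) (s^-1 *: (c d - c (d - s)) - 0)
    @[s --> (0 : R)^'+] --> dot v v.
  by have := continuous_cvg _ sq_cont cv; rewrite subr0; apply.
have chord s : 0 < s -> s <= d -> dot (s^-1 *: (c d - c (d - s)) - 0)
    (s^-1 *: (c d - c (d - s)) - 0) =
  match g with
  | Hyperbolic => height x * height (c (d - s)) * (s^-1 * (2 * sinh (s / 2))) ^+ 2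
  | Flat => 1
  end.
  move=> s0 sd; rewrite subr0 dot_sqrZ cx.
  have /(geodesic_chord Xx Xp geo) : 0 <= s <= dist g p x by rewrite ltW.
  rewrite -/d => -[Xc ds _]; rewrite (sqr_chord Xx Xc) ds.
  case: (g); first by rewrite [in RHS]exprMn mulrCA.
  by rewrite exprVn mulVf// expf_neq0// gt_eqF.
have dd : \forall s \near (0 : R)^'+, s <= d by exact: nbhs_right_ltW.
rewrite -(cvg_lim (@Rhausdorff R) lim1); apply: cvg_lim; first exact: Rhausdorff.
case: (g) chord => chord; rewrite [conformal_factor _ _]/=.
  have hw : height (c (d - s)) @[s --> (0 : R)^'+] --> height x.
    by apply: continuous_cvg wx; exact: (@coord_continuous R 1 m.+1 0 ord_max).
  have hs : (s^-1 * (2 * sinh (s / 2))) ^+ 2 @[s --> (0 : R)^'+] --> (1 : R).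
    by rewrite -[X in _ --> X](expr1n _ 2); apply: cvgM; exact: sinh_half_cvg.
  have := cvgM (cvgMl_tmp (a := height x) hw) hs.
  rewrite mulr1 -expr2 => /(_ _ _); apply: cvg_trans.
  apply: near_eq_cvg; near=> s.
  by rewrite chord; [|near: s; exact: nbhs_right_gt|near: s].
rewrite expr1n; apply: cvg_near_cst; near=> s.
by apply: chord; [near: s; exact: nbhs_right_gt|near: s].
Unshelve. all: by end_near.
Qed.

(** Along a geodesic arriving at x from p, the distance to p grows at unit
    speed; this is the chain rule for a one-sided derivative. *)
Lemma end_velocity_gradient g p x v G :
  model_space g x -> model_space g p -> x != p ->
  gradient_at (fun z => dist g z p) x G ->
  is_end_velocity g p x v -> dot G v = 1.
Proof.
move=> Xx Xp xp [du duE] [c geo cv]; have [c0 cx _] := geo.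
have d0 : 0 < dist g p x by rewrite distC dist_gt0.
have wx := geodesic_end_cvg cx cv.
set d := dist g p x in d0 cv cx c0 wx.
have Gv : dot G (s^-1 *: (c d - c (d - s))) @[s --> (0 : R)^'+] --> dot G v.
  by apply: continuous_cvg cv; exact: dot_continuous.
have le_e e : 0 < e -> `|1 - dot G v| <= e * `|v|.
  move=> e0.
  have l1 : `|1 - dot G (s^-1 *: (c d - c (d - s)))| @[s --> (0 : R)^'+] -->
      `|1 - dot G v|.
    by apply: cvg_norm; apply: cvgB Gv; exact: cvg_cst.
  have l2 : e * `|s^-1 *: (c d - c (d - s))| @[s --> (0 : R)^'+] --> e * `|v|.
    by apply: cvgMl_tmp; exact: cvg_norm.
  apply: ler_cvg_to l1 l2 _.
  have approx := wx _ (differentiable_approx du e0).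
  near=> s => /=.
  have s0 : 0 < s by near: s; exact: nbhs_right_gt.
  have sd : s <= d by near: s; exact: nbhs_right_ltW.
  have [_ _ dw] : [/\ model_space g (c (d - s)), dist g x (c (d - s)) = s
    & dist g (c (d - s)) p = d - s].
    by apply: geodesic_chord => //; rewrite ltW.
  have : `|dist g (c (d - s)) p - dist g x p - 'd (fun z => dist g z p) x (c (d - s) - x)|
    <= e * `|c (d - s) - x| by near: s.
  rewrite dw duE (_ : dist g x p = d); last exact: distC.
  have -> : c (d - s) - x = - (s *: (s^-1 *: (c d - c (d - s)))).
    by rewrite scalerA mulfV ?gt_eqF// scale1r cx opprB.
  move: (s^-1 *: _) => q; rewrite normrN normrZ linearN linearZ /=.
  rewrite (_ : _ - _ - _ = - (s * (1 - dot G q))); last by ring.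
  by rewrite normrN normrM (ger0_norm (ltW s0)) mulrCA ler_pM2l.
apply/esym/eqP; rewrite -subr_eq0 -normr_eq0; apply/negPn/negP => n0.
have n1 : 0 < `|1 - dot G v| by rewrite lt_neqAle eq_sym n0 normr_ge0.
have v1 : 0 < `|v| + 1 by rewrite ltr_wpDl.
have := le_e _ (divr_gt0 n1 v1); rewrite mulrAC ler_pdivlMr// ler_pM2l//; lra.
Unshelve. all: by end_near.
Qed.

(** Equality holds in the Cauchy-Schwarz inequality for the end velocity and
    the gradient of the distance. *)
Lemma end_velocity_unique g p x v G :
  model_space g x -> model_space g p -> x != p ->
  gradient_at (fun z => dist g z p) x G ->
  conformal_factor g x ^+ 2 * dot G G = 1 ->
  is_end_velocity g p x v -> v = conformal_factor g x ^+ 2 *: G.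
Proof.
move=> Xx Xp xp gG G1 vv; apply/subr0_eq/dot_eq0.
have Gv := end_velocity_gradient Xx Xp xp gG vv.
rewrite dot_sqrB (dotC v) Gv (end_velocity_norm Xx Xp xp vv).
move: G1; move: (conformal_factor g x ^+ 2) (dot G G) => r2 n G1.
by rewrite [r2 ^+ 2]expr2 -[r2 * r2 * n]mulrA G1; ring.
Qed.

Lemma unit_tangentE g p x G : model_space g x -> model_space g p -> x != p ->
  gradient_at (fun z => dist g z p) x G ->
  conformal_factor g x ^+ 2 * dot G G = 1 ->
  unit_tangent g p x = conformal_factor g x ^+ 2 *: G.
Proof.
move=> Xx Xp xp gG G1; have [v vv] := end_velocity_exists Xx Xp xp.
apply: (end_velocity_unique Xx Xp xp gG G1).
exact: (@getPex _ [set v | is_end_velocity g p x v] (ex_intro _ v vv)).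
Qed.

(** * The gradient of the potential of a point charge *)

Lemma even_derive0 (k : R -> R) : smooth_even k -> derive1 k 0 = 0.
Proof.
move=> [ke kd]; have dk : derivable k 0 1 := kd 0%N 0.
have dk' : is_derive (0 : R) 1 k ('D_1 k 0) by apply: derivableP.
have dN : is_derive (0 : R) 1 (-%R) (-1) by exact: is_deriveNid.
have dk0 : is_derive (- 0 : R) 1 k ('D_1 k 0) by rewrite oppr0.
have := is_derive1_comp dk0 dN.
have -> : k \o -%R = k by apply/funext => t /=; rewrite ke.
by move=> /(@derive_val _ _ _ _ _ _ _); rewrite derive1E mulrN1; lra.
Qed.

Lemma open_model_space g x : model_space g x -> \forall z \near x, model_space g z.
Proof.
case: g => [/= hx|_]; last exact: (@filterT _ _ (nbhs_filter x)).
have := @coord_continuous R 1 m.+1 0 ord_max x.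
by move/cvgr_gt => /(_ _ hx).
Qed.

(** Near p the distance is at most a multiple of the sup norm: as
    sinh(d/2) >= d/4, the square of d is at most 8 (cosh d - 1), which is
    quadratic in the coordinates. *)
Lemma dist_lipschitz g p : model_space g p ->
  exists2 C : R, 0 < C & \forall z \near p, dist g z p <= C * `|z - p|.
Proof.
case: g => /= [hp|_]; last first.
  exists m.+1%:R => //; apply: filterE => z.
  rewrite -(@ler_pXn2r _ 2)// ?nnegrE ?sqrtr_ge0 ?mulr_ge0// enorm_sqr.
  apply: le_trans (ler_norm _) _; apply: le_trans (dot_le_norm _ _) _.
  rewrite exprMn expr2 -[leLHS]mulrA -expr2 ler_wpM2r ?sqr_ge0//.
  by rewrite -[leLHS]mulr1 ler_wpM2l// ler1n.
(* With M = m.+1, height z > height p / 2 gives d^2 <= 8 M |z - p|^2 / height p ^2,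
   and 8 M <= (3 M)^2. *)
pose C := 3 * m.+1%:R / height p.
have C0 : 0 < C by rewrite divr_gt0 ?mulr_gt0.
have hz : \forall z \near p, height p / 2 < height z.
  have := @coord_continuous R 1 m.+1 0 ord_max p.
  by move/cvgr_gt; apply; rewrite -/(height p); lra.
exists C => //; apply: filterS hz => z hz.
have hz0 : 0 < height z by apply: lt_trans hz; rewrite divr_gt0.
pose d := dist Hyperbolic z p; rewrite -[leLHS]/d.
have d0 : 0 <= d by exact: dist_ge0.
have d4 : d / 4 <= sinh (d / 2).
  have e1 : expR (- (d / 2)) <= 1 by rewrite -[leRHS]expR0 ler_expR oppr_le0 divr_ge0.
  by have := expR_ge1Dx (d / 2); rewrite /sinh; lra.
have dq : d ^+ 2 <= 8 * (cosh_dist p z - 1).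
  rewrite -(cosh_distK hz0 hp) cosh_half -/d.
  have d40 : 0 <= d / 4 by rewrite divr_ge0.
  have : (d / 4) ^+ 2 <= sinh (d / 2) ^+ 2 by rewrite !expr2; apply: ler_pM.
  by rewrite exprMn; lra.
have Cn0 : 0 <= C * `|z - p| by rewrite mulr_ge0// ltW.
rewrite -(@ler_pXn2r _ 2)//; apply: le_trans dq _.
rewrite /cosh_dist addrAC subrr add0r enorm_sqr.
have := le_trans (ler_norm _) (dot_le_norm (z - p) (z - p)).
have M1 : 1 <= m.+1%:R :> R by rewrite ler1n.
rewrite /C; move: (dot _ _) `|z - p| (m.+1%:R) M1 (dot_ge0 (z - p)) => D n M M1 D0.
move: (height z) (height p) hz hz0 hp => a b ab a0 b0 Dn.
have b20 : 0 < b ^+ 2 by rewrite exprn_gt0.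
apply: (@le_trans _ _ (8 * (D / b ^+ 2))).
  by rewrite ler_wpM2l// ler_wpM2l// lef_pV2 ?posrE ?mulr_gt0//; nra.
rewrite [leRHS](_ : _ = 9 * (M ^+ 2 * n ^+ 2) / b ^+ 2); last by field; rewrite gt_eqF.
rewrite mulrA ler_wpM2r ?invr_ge0 ?(ltW b20)//.
have n2 := sqr_ge0 n; have : M * n ^+ 2 <= M ^+ 2 * n ^+ 2.
  by rewrite ler_wpM2r// expr2; nra.
have : 0 <= M ^+ 2 * n ^+ 2 by rewrite mulr_ge0 ?sqr_ge0.
by move: Dn; rewrite -mulrA -expr2; lra.
Qed.

(** Away from p this is the chain rule and the description of the unit tangent
    vector as a gradient.  At p, where the distance is not differentiable, the
    derivative of k vanishes and the distance is Lipschitz. *)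
Lemma gradient_potential g (k : R -> R) x p : smooth_even k ->
  model_space g x -> model_space g p ->
  gradient_at (fun z => k (dist g z p)) x
    (- (conformal_factor g x ^- 2) *: (if p == x then 0 else force_term g k x p)).
Proof.
move=> ke Xx Xp; have [px|px] := eqVneq p x.
  have [C C0 dC] := dist_lipschitz Xx.
  rewrite scaler0 px; apply: approx_differentiable => [||e e0].
  - exact: dot_is_linear.
  - exact: dot_continuous.
  have dk : derivable k 0 1 := ke.2 0%N 0.
  have /derivable1_diffP dk' := dk.
  have := differentiable_approx dk' (divr_gt0 e0 C0).
  move=> /nbhs_normP[d /= d0 dP].
  have xB : \forall z \near x, C * `|z - x| < d.
    apply/nbhs_normP; exists (d / C) => /=; first by rewrite divr_gt0.
    by move=> z /=; rewrite ltr_pdivlMr// mulrC distrC.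
  near=> z.
  have Xz : model_space g z by near: z; exact: open_model_space.
  have dz : dist g z x <= C * `|z - x| by near: z.
  have dz0 := dist_ge0 Xz Xx.
  have dzd : dist g z x < d by apply: le_lt_trans dz _; near: z.
  have := dP (dist g z x).
  rewrite /= !subr0 sub0r normrN ger0_norm// (diff1E dk') even_derive0// scaler0 subr0.
  rewrite distxx dotC linear0 subr0 => /(_ dzd)/le_trans; apply.
  rewrite -[e in leRHS](divfK (lt0r_neq0 C0)) -[leRHS]mulrA.
  by apply: ler_wpM2l => //; apply: divr_ge0; apply: ltW.
have xp : x != p by rewrite eq_sym.
have [G gG G1] := gradient_dist Xx Xp xp.
rewrite /force_term (unit_tangentE Xx Xp xp gG G1).
have dk : is_derive (dist g x p) 1 k (derive1 k (dist g x p)).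
  by rewrite derive1E; apply/derivableP; exact: (ke.2 0%N).
have := gradient_at_comp (u := fun z => dist g z p) dk gG; congr gradient_at.
have r0 := lt0r_neq0 (conformal_factor_gt0 Xx).
rewrite /force_law !scalerA; congr (_ *: _); field.
Unshelve. all: by end_near. Qed.

End end_velocities.

(** * Locally uniform series on a model space *)

Section model_space_series.
Variables (R : realType) (m : nat) (g : geometry).
Local Notation pt := 'rV[R]_m.+1.
Implicit Types (x y z p v w : pt).

Lemma small_tails_sub (I : choiceType) (S T : Type) (A : set S) (B : set T)
    (h : T -> S) (f : I -> S -> R) (f' : I -> T -> R) :
  (forall q, B q -> A (h q)) -> (forall i q, f' i q = f i (h q)) ->
  small_tails A f -> small_tails B f'.
Proof.
move=> BA ff tf e e0; have [J0 J0P] := tf e e0; exists J0 => L LJ0 q Bq.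
by under eq_bigr do rewrite ff; apply: J0P => //; exact: BA.
Qed.

(** Admissibility gives uniform convergence on compact sets only, so that
    the series lemmas are applied on such neighbourhoods. *)
Lemma model_space_compact_nbhs x : model_space g x ->
  exists (d : R) (K : set pt), [/\ 0 < d, compact K, K `<=` model_space g
    & forall z, `|z - x| < d -> K z].
Proof.
move=> Xx; have [r /= r0 rX] := (nbhs_normP _ _).1 (open_model_space Xx).
exists (r / 2), [set z : pt | forall i, `[x 0 i - r / 2, x 0 i + r / 2]%classic (z ord0 i)].
split; first by rewrite divr_gt0.
- exact: (@rV_compact R m.+1 (fun i => `[x 0 i - r / 2, x 0 i + r / 2]%classic)
    (fun i => @segment_compact _ _ _)).
- move=> z zK; apply: rX => /=; rewrite distrC.
  apply: (@le_lt_trans _ _ (r / 2)); last by lra.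
  rewrite [leLHS]/Num.norm /= mx_normrE; apply: bigmax_le => [|[i j] _]; first by lra.
  by rewrite (ord1 i) !mxE ler_norml; have := zK j; rewrite /= in_itv /=; lra.
- move=> z zx i; rewrite /= in_itv /=.
  have := le_lt_trans (coord_le_norm (z - x) i) zx.
  by rewrite !mxE ltr_norml; lra.
Qed.

Section series.
Variables (I : choiceType) (f : I -> pt -> pt -> R).
Hypothesis sf : C1_summable g f.

Lemma C1_has_sum x y : model_space g x -> model_space g y ->
  has_sum (fun i => f i x y : R^o) (summability.sum (fun i => f i x y : R^o)).
Proof.
move=> Xx Xy; have [|[S fS] _] := sf (compactU (@compact_set1 _ x) (@compact_set1 _ y)).
  by move=> z [->|->].
have tf := abs_unif_summable_tails fS.
apply: cauchy_cvg; apply: (@small_tails_cauchy R I R^o _ _ (x, y) (fun i q => f i q.1 q.2) tf).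
by split; [left|right].
Qed.

Lemma C1_has_sum_partials x y : model_space g x -> model_space g y ->
  has_sum (fun i => partials (f i ^~ y) x)
    (summability.sum (fun i => partials (f i ^~ y) x)).
Proof.
move=> Xx Xy; have [|_ [S fS]] := sf (compactU (@compact_set1 _ x) (@compact_set1 _ y)).
  by move=> z [->|->].
have tf := abs_unif_summable_tails (f := fun i x y => partials (f i ^~ y) x) fS.
apply: cauchy_cvg; apply: (@small_tails_cauchy R I 'rV[R]_m.+1 _ _ (x, y) (fun i q => partials (f i ^~ q.2) q.1) tf).
by split; [left|right].
Qed.

(** Used with G the neighbourhoods of y for the spectral series, where joint
    estimates are available, and with G concentrated at y for the series over the
    group, of which only the derivative in x for fixed y is computed. *)
Lemma C1_has_gradient (G : set_system pt) (F : pt -> pt -> R) x y :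
  Filter G -> model_space g x -> model_space g y ->
  (forall d, 0 < d -> G [set t | `|t - y| < d]) ->
  (forall i z t j, model_space g z -> model_space g t ->
    derivable (f i ^~ t) z (delta_mx 0 j)) ->
  (forall i, has_gradient G (fun t z => f i z t) x (partials (f i ^~ y) x)) ->
  (forall z t, model_space g z -> model_space g t ->
    has_sum (fun i => f i z t : R^o) (F z t)) ->
  has_gradient G (fun t z => F z t) x
    (summability.sum (fun i => partials (f i ^~ y) x)).
Proof.
move=> FG Xx Xy Gy df gf sF.
have [dx [Kx [dx0 cKx KxX xK]]] := model_space_compact_nbhs Xx.
have [dy [Ky [dy0 cKy KyX yK]]] := model_space_compact_nbhs Xy.
have [|_ [S fS]] := sf (compactU cKx cKy); first by move=> z [/KxX|/KyX].
have tf := abs_unif_summable_tails (f := fun i x y => partials (f i ^~ y) x) fS.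
apply: (@has_gradient_series R m I pt G [set t | `|t - y| < dy] y dx
  (fun i t z => f i z t)) => //.
- exact: Gy.
- by rewrite /= subrr normr0.
- by move=> i t z j /= /yK/KyX Xt /xK/KxX Xz; exact: df.
- apply: (@small_tails_sub I _ _ _ _ (fun q => (q.2, q.1)) _ _ _ _ tf) => //=.
  by move=> [t z] /= [/yK ? /xK ?]; split; [left|right].
- by move=> t z /= /yK/KyX Xt /xK/KxX Xz; exact: sF.
- exact: C1_has_sum_partials.
Qed.

End series.

End model_space_series.

(** * Gradients of pair energies *)

Section gradient_transfer.
Variables (R : realType) (m : nat).
Local Notation pt := 'rV[R]_m.+1.
Implicit Types (x y z p v w D : pt).

Lemma has_gradient_at (T : Type) (G : set_system T) (f : T -> pt -> R) x D (t : T) :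
  (forall A, G A -> A t) -> has_gradient G f x D -> gradient_at (f t) x D.
Proof.
move=> Gt fD; apply: approx_differentiable => [||e e0].
- exact: dot_is_linear.
- exact: dot_continuous.
have [[A B] /= [GA xB] AB] := fD e e0.
by apply: filterS xB => z Bz; apply: (AB (t, z)); split => //; exact: Gt.
Qed.

Lemma gradient_at_has_gradient (f : pt -> pt -> R) x y :
  differentiable (f y) x -> has_gradient (globally [set y]) f x (partials (f y) x).
Proof.
move=> fy e e0; have [_ fyE] := differentiable_partials fy.
exists ([set y], [set z | `|f y z - f y x - dot (partials (f y) x) (z - x)| <= e * `|z - x|]).
  by split => //=; rewrite -fyE; exact: (differentiable_approx fy e0).
by move=> [t z] /= [-> ].
Qed.

Lemma has_gradientD (T : Type) (G : set_system T) (f f' : T -> pt -> R) x D D' :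
  Filter G -> has_gradient G f x D -> has_gradient G f' x D' ->
  has_gradient G (fun t z => f t z + f' t z) x (D + D').
Proof.
move=> FG fD fD' e e0; have e2 : 0 < e / 2 by rewrite divr_gt0.
apply: filterS2 (fD _ e2) (fD' _ e2) => -[t z] /= h h'.
have -> : f t z + f' t z - (f t x + f' t x) - dot (D + D') (z - x) =
  (f t z - f t x - dot D (z - x)) + (f' t z - f' t x - dot D' (z - x)).
  by rewrite dotDl; ring.
by apply: le_trans (ler_normD _ _) _; rewrite [e]splitr mulrDl lerD.
Qed.

(** For a product of a function of z and a function of t, continuity in t makes
    the derivative in z uniform in t near y. *)
Lemma has_gradient_prod (u w : pt -> R) x y :
  differentiable u x -> {for y, continuous w} ->
  has_gradient (nbhs y) (fun t z => u z * w t) x (w y *: partials u x).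
Proof.
move=> du cw e e0; have [_ duE] := differentiable_partials du.
pose D := partials u x.
pose c := `|w y| + 1.
have c0 : 0 < c by rewrite ltr_wpDl.
pose c' := m.+1%:R * `|D| + 1.
have c'0 : 0 < c' by rewrite ltr_wpDl// mulr_ge0.
have e1 : 0 < e / 2 / c by rewrite !divr_gt0.
have e2 : 0 < e / 2 / c' by rewrite !divr_gt0.
have w1 : \forall t \near y, `|w y - w t| <= 1 by have /cvgrPdist_le/(_ _ ltr01) := cw.
have w2 : \forall t \near y, `|w y - w t| <= e / 2 / c' by have /cvgrPdist_le/(_ _ e2) := cw.
have ux := differentiable_approx du e1.
exists ([set t | `|w y - w t| <= 1 /\ `|w y - w t| <= e / 2 / c'],
  [set z | `|u z - u x - 'd u x (z - x)| <= e / 2 / c * `|z - x|]).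
  by split => //=; exact: filterI.
move=> [t z] /= [[w1t w2t]]; rewrite duE -/D => uz.
have -> : u z * w t - u x * w t - dot (w y *: D) (z - x) =
  (u z - u x - dot D (z - x)) * w t - dot D (z - x) * (w y - w t).
  by rewrite dotZl; ring.
apply: le_trans (ler_normB _ _) _; rewrite !normrM [e]splitr mulrDl; apply: lerD.
  have wt : `|w t| <= c.
    rewrite -[w t](subrK (w y)); apply: le_trans (ler_normD _ _) _.
    by rewrite distrC /c addrC lerD2l.
  apply: (@le_trans _ _ (e / 2 / c * `|z - x| * c)); first exact: ler_pM.
  by rewrite mulrAC divfK// gt_eqF.
apply: (@le_trans _ _ (m.+1%:R * `|D| * `|z - x| * (e / 2 / c'))).
  by apply: ler_pM => //; exact: dot_le_norm.
rewrite mulrC mulrA ler_wpM2r// -[leRHS](divfK (lt0r_neq0 c'0)).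
by rewrite ler_wpM2l ?(ltW e2)// /c' lerDl.
Qed.

End gradient_transfer.

Section pair_energy.
Variables (R : realType) (m : nat) (A : set 'rV[R]_m.+1).
Local Notation pt := 'rV[R]_m.+1.
Variables (Phi : pt -> pt -> R) (D : pt -> pt -> pt).
Hypothesis A_open : forall x, A x -> \forall z \near x, A z.
Hypothesis Phi_sym : forall x y, A x -> A y -> Phi x y = Phi y x.
Hypothesis Phi_gradient : forall x y, A x -> A y ->
  has_gradient (nbhs y) (fun t z => Phi z t) x (D x y).

Definition approx (V : normedModType R) (f : V -> R) (x : V) (l : V -> R) : Prop :=
  forall e, 0 < e -> \forall z \near x, `|f z - f x - l (z - x)| <= e * `|z - x|.

Lemma approxD (V : normedModType R) (f f' : V -> R) (x : V) (l l' : V -> R) :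
  approx f x l -> approx f' x l' ->
  approx (fun z => f z + f' z) x (fun h => l h + l' h).
Proof.
move=> fl fl' e e0; have e2 : 0 < e / 2 by rewrite divr_gt0.
apply: filterS2 (fl _ e2) (fl' _ e2) => z h h'.
have -> : f z + f' z - (f x + f' x) - (l (z - x) + l' (z - x)) =
  (f z - f x - l (z - x)) + (f' z - f' x - l' (z - x)) by ring.
by apply: le_trans (ler_normD _ _) _; rewrite [e]splitr mulrDl lerD.
Qed.

Lemma approx_sum (V : normedModType R) (I : Type) (r : seq I)
    (f l : I -> V -> R) (x : V) :
  (forall i, approx (f i) x (l i)) ->
  approx (fun z => \sum_(i <- r) f i z) x (fun h => \sum_(i <- r) l i h).
Proof.
move=> fl; elim: r => [|i r IH].
  move=> e e0; apply: nearW => z; rewrite !big_nil !subrr normr0.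
  by rewrite mulr_ge0// ltW.
have -> : (fun z => \sum_(j <- i :: r) f j z) =
    (fun z => f i z + \sum_(j <- r) f j z).
  by apply/funext => z; rewrite big_cons.
have -> : (fun z => \sum_(j <- i :: r) l j z) =
    (fun z => l i z + \sum_(j <- r) l j z).
  by apply/funext => z; rewrite big_cons.
exact: approxD.
Qed.

Variable N : nat.
Implicit Types X Y W : 'M[R]_(N, m.+1).

Lemma row_le_norm (j : 'I_N) W : `|row j W| <= `|W|.
Proof.
rewrite [leLHS]/Num.norm /= mx_normrE; apply: bigmax_le => // -[i k] _ /=.
rewrite mxE [leRHS]/Num.norm /= mx_normrE.
exact: (le_bigmax _ (fun ij : 'I_N * 'I_m.+1 => `|W ij.1 ij.2|) (j, k)).
Qed.

Lemma near_row (j : 'I_N) X (P : pt -> Prop) :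
  (\forall z \near row j X, P z) -> \forall Y \near X, P (row j Y).
Proof.
move=> /nbhs_normP[d /= d0 dP]; apply/nbhs_normP; exists d => //= Y /= XY.
by apply: dP => /=; rewrite -linearB; exact: le_lt_trans (row_le_norm _ _) XY.
Qed.

(** Moving the two points one after the other: the first move is controlled
    uniformly in the position of the second point, and the second move is a move
    of the first argument, by symmetry. *)
Lemma approx_pair (i j : 'I_N) X : A (row i X) -> A (row j X) ->
  approx (fun Y => Phi (row j Y) (row i Y)) X
    (fun W => dot (D (row j X) (row i X)) (row j W) +
              dot (D (row i X) (row j X)) (row i W)).
Proof.
move=> Ai Aj e e0; have e2 : 0 < e / 2 by rewrite divr_gt0.
have [[P Q] /= [iP jQ] PQ] := Phi_gradient Aj Ai e2.
have [[P' Q'] /= [jP' iQ'] PQ'] := Phi_gradient Ai Aj e2.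
have P'j : P' (row j X) by exact: nbhs_singleton jP'.
near=> Y.
have PY : P (row i Y) by near: Y; exact: near_row.
have QY : Q (row j Y) by near: Y; exact: near_row.
have Q'Y : Q' (row i Y) by near: Y; exact: near_row.
have AY : A (row i Y) by near: Y; apply: near_row; exact: A_open.
have := PQ (row i Y, row j Y) (conj PY QY).
have := PQ' (row j X, row i Y) (conj P'j Q'Y) => /=.
rewrite -!linearB /= (Phi_sym AY Aj) (Phi_sym Ai Aj) => h1 h2.
set a := Phi (row j Y) (row i Y) in h2 *; set b := Phi (row j X) (row i Y) in h1 h2.
set c := Phi (row j X) (row i X) in h1 *.
set u := dot _ _ in h2 *; set v := dot _ _ in h1 *.
have -> : a - c - (u + v) = (a - b - u) + (b - c - v) by ring.
apply: le_trans (ler_normD _ _) _; rewrite [e]splitr mulrDl; apply: lerD.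
  by apply: le_trans h2 _; rewrite ler_wpM2l ?(ltW e2)// row_le_norm.
by apply: le_trans h1 _; rewrite ler_wpM2l ?(ltW e2)// row_le_norm.
Unshelve. all: by end_near. Qed.

(** By symmetry, each point enters the energy of a configuration twice, so that
    the gradient in the j-th point is twice the sum of the gradients of the
    pair energies in their first variable. *)
Lemma pair_energy_critical (U : 'M[R]_(N, m.+1) -> R) (b : R) X :
  (forall j, A (row j X)) ->
  (forall Y, (forall j, A (row j Y)) ->
    U Y = \sum_j \sum_i Phi (row j Y) (row i Y) + b) ->
  differentiable U X /\
  ((forall W, 'd U X W = 0) <-> forall j, \sum_i D (row j X) (row i X) = 0).
Proof.
move=> AX UE.
pose S j : pt := 2 *: \sum_i D (row j X) (row i X).
pose l W : R := \sum_j dot (S j) (row j W).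
have ll : linear l.
  move=> a W W'; rewrite /l scaler_sumr -big_split; apply: eq_bigr => j _ /=.
  by rewrite linearP /= linearP.
have cl : continuous l.
  apply: continuous_big => [|j _ W]; first exact: add_continuous.
  apply: (@continuous_comp _ _ _ (row j) (dot (S j)) W); last exact: dot_continuous.
  by move=> P; exact: near_row.
have [dU dUE] : differentiable U X /\ 'd U X = l :> (_ -> R).
  apply: approx_differentiable => // e e0.
  have := approx_sum (index_enum 'I_N) (fun j => approx_sum (index_enum 'I_N)
    (fun i => approx_pair (AX i) (AX j))) e0.
  have AY : \forall Y \near X, forall j, A (row j Y).
    have := @filter_forall _ _ (fun j Y => A (row j Y)) (nbhs X) _; apply => j.
    by apply: near_row; exact: A_open.
  apply: filterS2 AY => Y AY.
  rewrite UE// UE// opprD addrACA subrr addr0.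
  congr (`| _ - _ | <= _).
  rewrite /l; under eq_bigr do rewrite big_split /=.
  rewrite big_split /= [X in _ + X]exchange_big /= -big_split /=.
  apply: eq_bigr => j _; rewrite -dot_suml -dotDl.
  by rewrite /S scaler_nat mulr2n.
split => //; rewrite dUE; split => [l0 j|S0 W].
  have := l0 (\matrix_(a, c) if a == j then S j 0 c else 0).
  rewrite /l (bigD1 j) //= big1 ?addr0 => [|i ij].
    have -> : row j (\matrix_(a, c) (if a == j then S j 0 c else 0)) = S j.
      by apply/rowP => c; rewrite !mxE eqxx.
    move=> /dot_eq0/eqP; rewrite scaler_eq0 pnatr_eq0 /= => /eqP //.
  have -> : row i (\matrix_(a, c) (if a == j then S j 0 c else 0)) = 0.
    by apply/rowP => c; rewrite !mxE (negbTE ij).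
  by rewrite linear0.
by rewrite /l big1// => j _; rewrite /S S0 scaler0 dotC linear0.
Qed.

End pair_energy.

(** * The potential of the lattice of images of a charge *)

Section complex_parts.
Variable R : realType.

Lemma ReD (z w : R[i]) : complex.Re (z + w) = complex.Re z + complex.Re w.
Proof. by case: z; case: w. Qed.

Lemma ImD (z w : R[i]) : complex.Im (z + w) = complex.Im z + complex.Im w.
Proof. by case: z; case: w. Qed.

Lemma Re_sum (J : Type) (r : seq J) (f : J -> R[i]) :
  complex.Re (\sum_(j <- r) f j) = \sum_(j <- r) complex.Re (f j).
Proof. exact: (big_morph _ ReD). Qed.

Lemma Im_sum (J : Type) (r : seq J) (f : J -> R[i]) :
  complex.Im (\sum_(j <- r) f j) = \sum_(j <- r) complex.Im (f j).
Proof. exact: (big_morph _ ImD). Qed.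

(** The real part of a spectral term is a sum of two products of a function of
    x and a function of y. *)
Lemma Re_mul_conj (h p q : R[i]) : complex.Re (h * p * (q^*)%C) =
  complex.Re p * (complex.Re h * complex.Re q + complex.Im h * complex.Im q) +
  complex.Im p * (complex.Re h * complex.Im q - complex.Im h * complex.Re q).
Proof. by case: h => a b; case: p => u v; case: q => u' v' /=; ring. Qed.

Lemma normc_sum_sqr (N : nat) (h : R[i]) (p : 'I_N -> R[i]) :
  h * `|\sum_j p j| ^+ 2 = \sum_j \sum_i h * p j * ((p i)^*)%C.
Proof.
rewrite sqr_normc rmorph_sum /= mulr_suml mulr_sumr; apply: eq_bigr => j _.
by rewrite mulrA mulr_sumr.
Qed.

End complex_parts.

Section image_potential.
Variables (R : realType) (m : nat) (Gam : groupType).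
Local Notation pt := 'rV[R]_m.+1.
Variables (act : Gam -> pt -> pt) (g : geometry) (k : R -> R) (F : set pt).
Variables (I : choiceType) (phi : I -> pt -> R[i]) (hv : I -> R[i]) (h0 : R[i]).
Hypothesis ke : smooth_even k.
Hypothesis actG : compact_space_form act g.
Hypothesis adm : admissible act g F k phi hv h0.
Implicit Types (x y z p v w : pt).

Definition image_potential x y : R :=
  summability.sum (fun a => k (dist g x (act a y)) : R^o).

Definition image_gradient x y : pt :=
  summability.sum (fun a => partials (fun z => k (dist g z (act a y))) x).

Let k_series : C1_summable g (fun a x y => k (dist g x (act a y))).
Proof. by have [h _ _ _] := adm; exact: h. Qed.

(** The element a contributes to K(x,y) what its inverse contributes to
    K(y,x). *)
Lemma image_potential_sym x y : model_space g x -> model_space g y ->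
  image_potential x y = image_potential y x.
Proof.
move=> Xx Xy; have := C1_has_sum k_series Xy Xx.
move=> /(has_sum_reindex (@invgK Gam) (@invgK Gam)) h.
rewrite /image_potential -(has_sum_sum h); congr summability.sum.
apply/funext => a /=; have Xa := deck_stable actG a^-1 Xx.
rewrite distC -(deck_isometry actG a^-1 (deck_stable actG a Xy) Xx).
by rewrite -(deck_actM actG _ _ Xy) mulVg (deck_act1 actG Xy).
Qed.

Lemma image_gradient_at x y : model_space g x -> model_space g y ->
  gradient_at (image_potential ^~ y) x (image_gradient x y).
Proof.
move=> Xx Xy.
apply: (@has_gradient_at _ _ _ (globally [set y]) (fun t z => image_potential z t)).
  by move=> A; apply.
have dk a z t : model_space g z -> model_space g t ->
    differentiable (fun z => k (dist g z (act a t))) z.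
  by move=> Xz Xt; have [] := gradient_potential ke Xz (deck_stable actG a Xt).
apply: (C1_has_gradient k_series) => //.
- by move=> d d0 t /= ->; rewrite subrr normr0.
- by move=> a z t j Xz Xt; apply: diff_derivable; exact: dk.
- move=> a; apply: (gradient_at_has_gradient (f := fun t z => k (dist g z (act a t)))).
  exact: dk.
- by move=> z t Xz Xt; exact: (C1_has_sum k_series).
Qed.

Lemma scaled_partials x y a : model_space g x -> model_space g y ->
  - (conformal_factor g x ^+ 2) *: partials (fun z => k (dist g z (act a y))) x =
  if act a y == x then 0 else force_term g k x (act a y).
Proof.
move=> Xx Xy; have r0 := lt0r_neq0 (conformal_factor_gt0 Xx).
rewrite (gradient_at_partials (gradient_potential ke Xx (deck_stable actG a Xy))).
by rewrite scalerA mulrNN mulfV ?scale1r// expf_neq0.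
Qed.

Lemma effectE x y : model_space g x -> model_space g y ->
  effect act g k x y = - (conformal_factor g x ^+ 2) *: image_gradient x y.
Proof.
move=> Xx Xy; have := @has_sumZ _ _ _ (- (conformal_factor g x ^+ 2)) _ _
  (C1_has_sum_partials k_series Xx Xy).
move=> /has_sum_sum <-.
by congr summability.sum; apply/funext => a; rewrite scaled_partials.
Qed.

(** By freeness of the action, the identity is the only element that maps x to
    itself, so that the self action drops the same term as the action of x seen as
    a different charge. *)
Lemma self_effectE x : model_space g x ->
  self_effect act g k x = - (conformal_factor g x ^+ 2) *: image_gradient x x.
Proof.
move=> Xx; rewrite -effectE//; congr summability.sum; apply/funext => a.
have [->|a1] := eqVneq a 1%g; first by rewrite (deck_act1 actG Xx) eqxx.
by case: eqP => // /(deck_free actG Xx) a1'; rewrite a1' eqxx in a1.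
Qed.

Lemma equilibriumE (N : nat) (X : 'M[R]_(N, m.+1)) :
  (forall j, model_space g (row j X)) ->
  equilibrium act g k X <->
  forall j, \sum_i image_gradient (row j X) (row i X) = 0.
Proof.
move=> XX.
have E j : \sum_(i < N) (if i == j then self_effect act g k (row j X)
                  else effect act g k (row j X) (row i X)) =
    - (conformal_factor g (row j X) ^+ 2) *:
      \sum_i image_gradient (row j X) (row i X).
  rewrite scaler_sumr; apply: eq_bigr => i _.
  by have [->|_] := eqVneq i j; rewrite ?self_effectE ?effectE.
have r0 j : - (conformal_factor g (row j X) ^+ 2) != 0.
  by rewrite oppr_eq0 expf_neq0// lt0r_neq0// conformal_factor_gt0.
split=> eq j; first by apply: (scalerI (r0 j)); rewrite -E eq scaler0.
by rewrite E eq scaler0.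
Qed.

Hypothesis dphi : forall i x, model_space g x ->
  differentiable (fun z => complex.Re (phi i z)) x /\
  differentiable (fun z => complex.Im (phi i z)) x.

Let term i x y : R[i] := hv i * phi i x * ((phi i y)^*)%C.

Let Re_series : C1_summable g (fun i x y => complex.Re (term i x y)).
Proof. by have [_ h _ _] := adm; exact: h. Qed.

Let Im_series : C1_summable g (fun i x y => complex.Im (term i x y)).
Proof. by have [_ _ h _] := adm; exact: h. Qed.

(** The real and imaginary parts of the pre-trace formula: the left-hand side is
    real, so the imaginary parts sum to a constant. *)
Lemma spectral_sum x y : model_space g x -> model_space g y ->
  has_sum (fun i => complex.Re (term i x y) : R^o)
    (image_potential x y - complex.Re (h0 / ((volume g F)%:C)%C)) /\
  has_sum (fun i => complex.Im (term i x y) : R^o)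
    (- complex.Im (h0 / ((volume g F)%:C)%C)).
Proof.
move=> Xx Xy; case: adm => _ _ _ /(_ _ _ Xx Xy); rewrite -/(image_potential x y).
set c := h0 / _ => E.
have := congr1 (@complex.Re R) E; have := congr1 (@complex.Im R) E.
rewrite ReD ImD /= => ImE ReE.
split.
  have := C1_has_sum Re_series Xx Xy.
  by rewrite (_ : summability.sum _ = image_potential x y - complex.Re c)// ReE addrC addKr.
have := C1_has_sum Im_series Xx Xy.
by rewrite (_ : summability.sum _ = - complex.Im c)//; apply/eqP; rewrite -addr_eq0 addrC -ImE.
Qed.

Lemma Re_term_gradient i x y : model_space g x -> model_space g y ->
  differentiable (fun z => complex.Re (term i z y)) x /\
  has_gradient (nbhs y) (fun t z => complex.Re (term i z t)) x
    (partials (fun z => complex.Re (term i z y)) x).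
Proof.
move=> Xx Xy; have [du dv] := dphi i Xx; have [du' dv'] := dphi i Xy.
have cu := differentiable_continuous du'; have cv := differentiable_continuous dv'.
pose a := complex.Re (hv i); pose b := complex.Im (hv i).
have termE : (fun t z => complex.Re (term i z t)) =
  (fun t z => complex.Re (phi i z) * (a * complex.Re (phi i t) + b * complex.Im (phi i t)) +
    complex.Im (phi i z) * (a * complex.Im (phi i t) - b * complex.Re (phi i t))).
  by apply/funext => t; apply/funext => z; exact: Re_mul_conj.
have c1 : {for y, continuous (fun t => a * complex.Re (phi i t) + b * complex.Im (phi i t))}.
  exact: (cvgD (cvgMl_tmp (a := a) cu) (cvgMl_tmp (a := b) cv)).
have c2 : {for y, continuous (fun t => a * complex.Im (phi i t) - b * complex.Re (phi i t))}.
  exact: (cvgB (cvgMl_tmp (a := a) cv) (cvgMl_tmp (a := b) cu)).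
have G := has_gradientD (nbhs_filter y) (has_gradient_prod du c1) (has_gradient_prod dv c2).
rewrite -termE in G.
have gr := has_gradient_at (fun A => @nbhs_singleton _ y A) G.
by split; [case: gr|rewrite (gradient_at_partials gr)].
Qed.

(** The spectral series shows that the gradient is uniform in the second
    argument; the series over the group, which computes the gradient for a fixed
    second argument, tells what it is. *)
Lemma image_potential_gradient x y : model_space g x -> model_space g y ->
  has_gradient (nbhs y) (fun t z => image_potential z t) x (image_gradient x y).
Proof.
move=> Xx Xy; set c := complex.Re (h0 / ((volume g F)%:C)%C).
have G : has_gradient (nbhs y) (fun t z => image_potential z t - c) x
    (summability.sum (fun i => partials (fun z => complex.Re (term i z y)) x)).
  apply: (C1_has_gradient (F := fun z t => image_potential z t - c) Re_series) => //.
  - move=> d d0; suff : \forall t \near y, `|t - y| < d by [].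
    by apply/nbhs_normP; exists d => //= t /=; rewrite distrC.
  - by move=> i z t j Xz Xt; apply: diff_derivable; have [] := Re_term_gradient i Xz Xt.
  - by move=> i; have [] := Re_term_gradient i Xx Xy.
  - by move=> z t Xz Xt; have [] := spectral_sum Xz Xt.
have G' : has_gradient (nbhs y) (fun t z => image_potential z t) x
    (summability.sum (fun i => partials (fun z => complex.Re (term i z y)) x)).
  move=> e e0; apply: filterS (G e e0) => -[t z] /=.
  by rewrite opprB addrA subrK.
have gr := has_gradient_at (fun A => @nbhs_singleton _ y A) G'.
by rewrite -(gradient_at_partials (image_gradient_at Xx Xy)) (gradient_at_partials gr).
Qed.

(** On configurations in the model space, the energy has as real part a sum of
    pair energies up to a constant, and a constant imaginary part; hence only the
    real part matters for critical points. *)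
Lemma equilibrium_energy (N : nat) (X : 'M[R]_(N, m.+1)) :
  (forall j, model_space g (row j X)) ->
  equilibrium act g k X <->
  critical_point (fun Y : 'M[R]_(N, m.+1) =>
    csum (fun i => hv i * `|\sum_(j < N) phi i (row j Y)| ^+ 2)) X.
Proof.
move=> XX; set E := (fun Y => csum _).
pose c := h0 / ((volume g F)%:C)%C.
have EE Y : (forall j, model_space g (row j Y)) ->
    complex.Re (E Y) = \sum_j \sum_i (image_potential (row j Y) (row i Y) - complex.Re c) /\
    complex.Im (E Y) = \sum_(j < N) \sum_(i < N) - complex.Im c.
  move=> XY; rewrite /E /csum /=.
  have tE i : hv i * `|\sum_(j < N) phi i (row j Y)| ^+ 2 =
    \sum_j \sum_l term i (row j Y) (row l Y) by exact: normc_sum_sqr.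
  split; apply: has_sum_sum.
    rewrite (_ : (fun _ => _) = fun i =>
      \sum_j \sum_l (complex.Re (term i (row j Y) (row l Y)) : R^o)).
      apply: has_sum_big => j; apply: has_sum_big => l.
      by have [] := spectral_sum (XY j) (XY l).
    apply/funext => i; rewrite tE Re_sum; apply: eq_bigr => j _; exact: Re_sum.
  rewrite (_ : (fun _ => _) = fun i =>
    \sum_j \sum_l (complex.Im (term i (row j Y) (row l Y)) : R^o)).
    apply: has_sum_big => j; apply: has_sum_big => l.
    by have [] := spectral_sum (XY j) (XY l).
  apply/funext => i; rewrite tE Im_sum; apply: eq_bigr => j _; exact: Im_sum.
have ReE Y : (forall j, model_space g (row j Y)) -> complex.Re (E Y) =
    \sum_j \sum_i image_potential (row j Y) (row i Y)
    - \sum_(j < N) \sum_(i < N) complex.Re c.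
  move=> XY; rewrite (proj1 (EE Y XY)) -sumrB; apply: eq_bigr => j _ /=.
  by rewrite -sumrB.
have [dRe ReP] := pair_energy_critical (@open_model_space R m g)
  image_potential_sym image_potential_gradient XX ReE.
have [dIm ImP] : differentiable (fun Y => complex.Im (E Y)) X /\
    'd (fun Y => complex.Im (E Y)) X = (fun=> 0) :> ('M[R]_(N, m.+1) -> R).
  apply: approx_differentiable => [a x y||e e0].
  - by rewrite scaler0 addr0.
  - exact: cst_continuous.
  have XY : \forall Y \near X, forall j, model_space g (row j Y).
    have := @filter_forall _ _ (fun j Y => model_space g (row j Y)) (nbhs X) _; apply => j.
    by apply: near_row; exact: open_model_space.
  apply: filterS XY => Y XY.
  by rewrite (EE Y XY).2 (EE X XX).2 !subrr normr0 mulr_ge0// ltW.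
rewrite equilibriumE// -ReP; split=> [Re0 u [->|->]|crit].
- by split.
- by split=> [|w]; [exact: dIm|rewrite ImP].
by have [] := crit _ (or_introl erefl).
Qed.

End image_potential.

(** * Smoothness of the eigenfunctions *)

Section eigenfunctions.
Variables (R : realType) (m : nat).
Local Notation pt := 'rV[R]_m.+1.

Lemma C2_differentiable (u : pt -> R) x :
  Ck 2 (model_space Hyperbolic) u -> model_space Hyperbolic x -> differentiable u x.
Proof.
move=> [_ du] Xx; apply: continuous_partials_differentiable => [|i].
  apply: filterS (open_model_space (g := Hyperbolic) Xx) => z Xz i.
  by have [dui _] := du i; exact: dui.
by have [_ [cui _]] := du i; exact: cui.
Qed.

Lemma torus_character_differentiable (nu x : pt) :
  differentiable (fun z => complex.Re (torus_character nu z)) x /\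
  differentiable (fun z => complex.Im (torus_character nu z)) x.
Proof.
have gl : gradient_at (fun z => 2 * pi * dot nu z) x ((2 * pi) *: nu).
  apply: approx_differentiable => [||e e0].
  - exact: dot_is_linear.
  - exact: dot_continuous.
  apply: filterE => z; rewrite dotZl linearB /= (_ : _ - _ = 0); last by ring.
  by rewrite normr0 mulr_ge0// ltW.
split.
  by have [] := gradient_at_comp (is_derive_cos _) gl.
by have [] := gradient_at_comp (is_derive_sin _) gl.
Qed.

End eigenfunctions.

Unset Implicit Arguments.

Theorem mainTheorem1 (R : realType) (m : nat) (Gam : groupType)
    (act : Gam -> 'rV[R]_m.+1 -> 'rV[R]_m.+1) (F : set 'rV[R]_m.+1)
    (k : R -> R) :
  smooth_even k ->
  (* compact hyperbolic manifolds *)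
  (compact_space_form act Hyperbolic ->
   fundamental_domain act Hyperbolic F ->
   forall (lam : nat -> R) (r : nat -> R[i]) (phi : nat -> 'rV[R]_m.+1 -> R[i])
     (h : R[i] -> R[i]),
   laplace_spectral_data act F lam r phi ->
   selberg_transform k r phi h ->
   admissible act Hyperbolic F k phi (fun n => h (r n)) (h (trivial_r R m)) ->
   (forall (N : nat) (X : 'M[R]_(N, m.+1)), (0 < N)%N ->
      (forall j, model_space Hyperbolic (row j X)) ->
      (equilibrium act Hyperbolic k X <->
       critical_point (fun Y : 'M[R]_(N, m.+1) =>
         csum (fun n => h (r n) * `|\sum_(j < N) phi n (row j Y)| ^+ 2)) X))
   /\
   (forall x : 'rV[R]_m.+1, model_space Hyperbolic x ->
      (self_equilibrium act Hyperbolic k x <->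
       critical_point (fun y : 'rV[R]_m.+1 =>
         csum (fun n => h (r n) * `|phi n y| ^+ 2)) x)))
  /\
  (* flat tori of unit volume *)
  (compact_space_form act Flat ->
   acts_by_translations act ->
   fundamental_domain act Flat F ->
   volume Flat F = 1 ->
   forall h : 'rV[R]_m.+1 -> R[i],
   fourier_transform k h ->
   admissible act Flat F k
     (fun nu : nonzero_dual_lattice act => torus_character (dual_vector nu))
     (fun nu : nonzero_dual_lattice act => h (dual_vector nu)) (h 0) ->
   (forall (N : nat) (X : 'M[R]_(N, m.+1)), (0 < N)%N ->
      (equilibrium act Flat k X <->
       critical_point (fun Y : 'M[R]_(N, m.+1) =>
         csum (fun nu : nonzero_dual_lattice act =>
           h (dual_vector nu) *
           `|\sum_(j < N) torus_character (dual_vector nu) (row j Y)| ^+ 2)) X))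
   /\
   (forall x : 'rV[R]_m.+1,
      (self_equilibrium act Flat k x <->
       critical_point (fun y : 'rV[R]_m.+1 =>
         csum (fun nu : nonzero_dual_lattice act =>
           h (dual_vector nu) * `|torus_character (dual_vector nu) y| ^+ 2)) x))).
Proof.
have single (I : choiceType) (hv : I -> R[i]) (phi : I -> 'rV[R]_m.+1 -> R[i]) :
    (fun y : 'rV[R]_m.+1 => csum (fun i => hv i * `|phi i y| ^+ 2)) =
    (fun Y : 'M[R]_(1, m.+1) =>
      csum (fun i => hv i * `|\sum_(j < 1) phi i (row j Y)| ^+ 2)).
  apply/funext => y; congr csum; apply/funext => i.
  by rewrite big_ord1 row_id.
move=> ke; split.
  move=> actG _ lam r phi h spec _ adm.
  have dphi n x : model_space Hyperbolic x ->
      differentiable (fun z => complex.Re (phi n z)) x /\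
      differentiable (fun z => complex.Im (phi n z)) x.
    move=> Xx; have eigen := phi_eigen spec (n := n).
    have [C2Re _] := eigen _ (or_introl erefl).
    have [C2Im _] := eigen _ (or_intror erefl).
    by split; [exact: C2_differentiable C2Re Xx|exact: C2_differentiable C2Im Xx].
  split=> [N X _ XX|x Xx]; first exact: (equilibrium_energy ke actG adm dphi).
  rewrite single; apply: (equilibrium_energy ke actG adm dphi) => j.
  by rewrite row_id.
move=> actG _ _ _ h _ adm.
have dphi (nu : nonzero_dual_lattice act) x : model_space Flat x ->
    differentiable (fun z => complex.Re (torus_character (dual_vector nu) z)) x /\
    differentiable (fun z => complex.Im (torus_character (dual_vector nu) z)) x.
  by move=> _; exact: torus_character_differentiable.
split=> [N X _|x]; first by apply: (equilibrium_energy ke actG adm dphi).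
by rewrite single; apply: (equilibrium_energy ke actG adm dphi).
Qed.
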